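(* Let $D\subset\mathbb{C}^p$ and $G\subset\mathbb{C}^q$ ($p,q\ge 2$) be pseudoconvex domains. Then there is a relatively closed set $S\subset D\times G$ with the following properties: (i) $\operatorname{int}S=\varnothing$ and $S$ does not separate domains in $D\times G$; (ii) let $A$ (resp. $B$) be the set of all $a\in D$ (resp. $b\in G$) such that $\operatorname{int}_{\mathbb{C}^q}S(a,\cdot)=\varnothing$ (resp. $\operatorname{int}_{\mathbb{C}^p}S(\cdot,b)=\varnothing$), and put $X:=(A\times G)\cup(D\times B)$; then there exists a function $f:X\setminus S\to\mathbb{C}$ which is separately holomorphic on $X$ and such that there is no function $\hat f\in\mathcal{M}(D\times G)$ with $\hat f=f$ on $X\setminus S$.
   Context: $\mathcal{M}(\Omega)$ denotes the space of meromorphic functions on $\Omega$. For $S\subset D\times G$, $a\in D$, $b\in G$: $S(a,\cdot):=\{w\in G:(a,w)\in S\}$ and $S(\cdot,b):=\{z\in D:(z,b)\in S\}$. $\operatorname{int}$ denotes the interior, $\operatorname{int}_{\mathbb{C}^k}$ the interior in $\mathbb{C}^k$ (and $\operatorname{int}S$ is the interior of $S$ in $\mathbb{C}^{p+q}$). A subset $S$ of a domain $\Omega$ does not separate domains in $\Omega$ if for every domain $U\subset\Omega$ the set $U\setminus S$ is connected. A function $f:X\setminus S\to\mathbb{C}$ is separately holomorphic on $X$ if for every $a\in A$ the function $f(a,\cdot)$, defined on $G\setminus S(a,\cdot)$, extends to a holomorphic function on $G$, and for every $b\in B$ the function $f(\cdot,b)$, defined on $D\setminus S(\cdot,b)$,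 extends to a holomorphic function on $D$. *)

(* Defs.v *)
From HB Require Import structures.
From mathcomp Require Import all_boot all_order all_algebra.
From mathcomp Require Import complex.
From mathcomp Require Import all_classical all_reals all_analysis.

Set Implicit Arguments.
Unset Strict Implicit.
Unset Printing Implicit Defensive.

Import Order.TTheory GRing.Theory Num.Theory.
Import numFieldNormedType.Exports.

Local Open Scope classical_set_scope.
Local Open Scope ring_scope.

(* The topology and norm that every numClosedFieldType carries over itself. *)
HB.instance Definition _ (R : realType) := NormedModule.copy R[i] R[i]^o.

(* C^n is 'rV[R[i]]_n, and C^p x C^q is the product
   of normed modules 'rV[R[i]]_p * 'rV[R[i]]_q; both carry the sup norm. *)

Definition domain (T : topologicalType) (U : set T) : Prop :=
  [/\ U !=set0, open U & connected U].

Definition relatively_closed (T : topologicalType) (Om S : set T) : Prop :=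
  exists2 F : set T, closed F & S = Om `&` F.

Definition does_not_separate_domains (T : topologicalType) (Om S : set T) :
    Prop :=
  forall U : set T, domain U -> U `<=` Om -> connected (U `\` S).

(* To be used with Om open.  The scalars of V are complex, hence
   [differentiable] means complex (Frechet) differentiable. *)
Definition holomorphic_on (R : realType) (V : normedModType R[i]) (Om : set V)
    (f : V -> R[i]) : Prop :=
  forall z, Om z -> differentiable f z.

(* The values -oo are allowed and +oo is not.  The last clause is the sub-mean
   value inequality on every closed disc {a + l b : |l| <= 1} contained in Om;
   since u is bounded above on the boundary circle, its integral makes sense,
   possibly as -oo. *)
Definition plurisubharmonic_on (R : realType) (n : nat)
    (Om : set 'rV[R[i]]_n) (u : 'rV[R[i]]_n -> \bar R) : Prop :=
  [/\ forall z, Om z -> (u z < +oo)%E,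
      forall z (c : R), Om z -> (u z < c%:E)%E ->
        \forall y \near z, (u y < c%:E)%E
    & forall a b : 'rV[R[i]]_n,
        (forall l : R[i], `|l| <= 1 -> Om (a + l *: b)) ->
        (u a <= ((2 * pi)^-1)%:E *
           \int[lebesgue_measure]_(t in `[0%R, (2 * pi)%R])
              u (a + (cos t +i* sin t)%C *: b)%R)%E].

(* Existence of a continuous plurisubharmonic exhaustion function. *)
Definition pseudoconvex (R : realType) (n : nat) (D : set 'rV[R[i]]_n) : Prop :=
  exists u : 'rV[R[i]]_n -> R,
    [/\ {in D, continuous u},
        plurisubharmonic_on D (EFin \o u)
      & forall c : R, exists2 K : set 'rV[R[i]]_n,
          compact K /\ K `<=` D & [set z | D z /\ u z < c] `<=` K].

(* A meromorphic function on Om is encoded by its singular set P (poles and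
   points of indeterminacy) and its values h on Om `\` P.  Locally it is a
   quotient phi / psi with psi not a zero divisor.  The last clause says that P
   is exactly the set of points at which the function is not holomorphic, so
   that P, and h on Om `\` P, are determined by the meromorphic function; the
   values of h elsewhere are irrelevant. *)
Definition meromorphic_on (R : realType) (V : normedModType R[i]) (Om : set V)
    (P : set V) (h : V -> R[i]) : Prop :=
  [/\ relatively_closed Om P,
      holomorphic_on (Om `\` P) h,
      forall a, Om a -> exists (U : set V) (phi psi : V -> R[i]),
        [/\ [/\ open U, U a & U `<=` Om],
            holomorphic_on U phi /\ holomorphic_on U psi,
            [set z | U z /\ psi z = 0]° = set0
          & forall z, U z -> ~ P z -> psi z * h z = phi z]
    & forall a, P a -> ~ exists (U : set V) (g : V -> R[i]),
        [/\ open U, U a, holomorphic_on U g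
          & forall z, U z -> ~ P z -> g z = h z]].

Definition thin_x (X Y : topologicalType) (D : set X) (S : set (X * Y)) :
    set X :=
  [set a | D a /\ (xsection S a)° = set0].

Definition thin_y (X Y : topologicalType) (G : set Y) (S : set (X * Y)) :
    set Y :=
  [set b | G b /\ (ysection S b)° = set0].

Definition cross (X Y : Type) (D A : set X) (G B : set Y) : set (X * Y) :=
  (A `*` G) `|` (D `*` B).

(* For f : cross D A G B `\` S -> C; a total f represents such a function, and
   only its values on that set are used. *)
Definition separately_holomorphic (R : realType) (V W : normedModType R[i])
    (D A : set V) (G B : set W) (S : set (V * W)) (f : V * W -> R[i]) : Prop :=
  (forall a, A a -> exists2 g : W -> R[i], holomorphic_on G g &
     forall w, (G `\` xsection S a) w -> g w = f (a, w)) /\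
  (forall b, B b -> exists2 g : V -> R[i], holomorphic_on D g &
     forall z, (D `\` ysection S b) z -> g z = f (z, b)).

(* Main.v *)
(* Write a point of C^p x C^q near a base point as (z, w), with normalized first
   two coordinates z1, z2 and w1, w2.  The function is a series
     f(z, w) = sum_n theta_n(z1) theta_n(z2) theta_n(w1) theta_n(w2)
   where theta_(n+1)(t) = c_n theta_n(t)^(k_n) (t - beta_n).  The sequence beta is
   dense in C but avoids a compact set Gamma, the boundaries of the squares of
   half-side 2^-m centred at 0 together with 0.  Since p >= 2, the hyperplanes
   z1 = beta_j and z2 = beta_j form a locally connected dense set H, on which the
   series terminates.  With k_n large, the series converges for all w as soon as z
   is extremely well approximated by H, that is, inf_j |z_i - beta_j| / eta_j = 0
   for i = 1 or 2, where eta_j > 0 is tiny.  The set S is the set of (z, w) such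
   that |z_i - beta_j| >= kappa rho(w) eta_j for all i and j, where
   rho(w) = |w1 - 1| + |w2 - 1|, together with its analogue with z and w exchanged.
   It does not meet H x H', H' being the analogue of H for w, which gives (i); its
   slices over the badly approximable points have interior points, so that f is
   defined and separately holomorphic on X.
   If f extended to a quotient phi / psi near the base point, then psi f would be
   bounded.  The constants c_n are so large that |theta_n| is huge on Gamma, and
   beta accumulates at every point of Gamma; hence f is unbounded near all points
   with z1, z2, w1, w2 in the boundary of one small square.  So psi = 0 there,
   and psi = 0 in the interior by the one-variable uniqueness theorem for
   functions vanishing on the boundary of a square, used four times. *)

Require Import Defs.
From HB Require Import structures.
From mathcomp Require Import all_boot all_order all_algebra.
From mathcomp Require Import complex.
From mathcomp Require Import all_classical all_reals all_analysis.
From mathcomp Require Import zify ring lra.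

Set Implicit Arguments.
Unset Strict Implicit.
Unset Printing Implicit Defensive.

Import Order.TTheory GRing.Theory Num.Theory.
Import numFieldNormedType.Exports.

Local Open Scope classical_set_scope.
Local Open Scope ring_scope.

(** * Integration over rectangles *)

Lemma exists_half_lt (R : realType) (D d : R) : 0 < d ->
  exists n, D / 2 ^+ n < d.
Proof.
move=> d0; exists (Num.bound (D / d)).
by rewrite ltr_pdivrMr ?exprn_gt0 // mulrC -ltr_pdivrMr // upper_nthrootP.
Qed.

Definition seg_int (R : realType) (f : R -> R) (a b : R) : R :=
  \int[lebesgue_measure]_(t in `[a, b]) f t.

Lemma seg_int_split (R : realType) (f : R -> R) (a m b : R) :
  a <= m -> m <= b -> {within `[a, b], continuous f} ->
  seg_int f a b = seg_int f a m + seg_int f m b.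
Proof.
move=> am mb cf.
have intf : lebesgue_measure.-integrable `[a, b] (EFin \o f).
  by apply: continuous_compact_integrable => //; exact: segment_compact.
have := @Rintegral_itvB R f (BLeft a) (BRight b) m intf.
rewrite !bnd_simp => /(_ am mb) H.
rewrite /seg_int -(@Rintegral_itv_obnd_cbnd _ m (BRight b)) -?H; first by lra.
apply: integrableS intf => //.
by apply: subset_itv; rewrite bnd_simp.
Qed.

Lemma seg_int_le (R : realType) (f g : R -> R) (a b : R) :
  {within `[a, b], continuous f} -> {within `[a, b], continuous g} ->
  (forall t, a <= t <= b -> f t <= g t) -> seg_int f a b <= seg_int g a b.
Proof.
move=> cf cg fg; apply: le_Rintegral => //.
- by apply: continuous_compact_integrable => //; exact: segment_compact.
- by apply: continuous_compact_integrable => //; exact: segment_compact.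
Qed.

Lemma seg_int_affine (R : realType) (c d a b : R) : a <= b ->
  seg_int (fun t => c + d * t) a b = c * (b - a) + d * (b ^+ 2 - a ^+ 2) / 2.
Proof.
rewrite le_eqVlt => /predU1P[->|ab].
  by rewrite /seg_int set_itv1 Rintegral_set1; ring.
pose F t : R := c * t + d * t ^+ 2 / 2.
have dF (x : R) : is_derive x 1 F (c + d * x).
  rewrite /F; apply: is_derive_eq; by rewrite /GRing.scale /=; field.
have cF : continuous F.
  move=> x; apply/differentiable_continuous/derivable1_diffP.
  by case: (dF x).
rewrite /seg_int /Rintegral (@continuous_FTC2 _ _ F).
- by rewrite -EFinB /= /F; field.
- by [].
- apply: continuous_subspaceT => x.
  by apply: cvgD; [exact: cvg_cst | apply: cvgM; [exact: cvg_cst|exact: cvg_id]].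
- split.
  + by move=> x _; case: (dF x).
  + by apply: cvg_at_right_filter; exact: cF.
  + by apply: cvg_at_left_filter; exact: cF.
- by move=> x _; rewrite derive1E; case: (dF x).
Qed.

(** Squeezes f between two affine functions of slope d at height e above and below, whose integrals
    are explicit. *)
Lemma seg_int_near_affine (R : realType) (f : R -> R) (c d e a b : R) :
  a <= b -> {within `[a, b], continuous f} ->
  (forall t, a <= t <= b -> `|f t - (c + d * t)| <= e) ->
  `|seg_int f a b - (c * (b - a) + d * (b ^+ 2 - a ^+ 2) / 2)| <= e * (b - a).
Proof.
move=> ab cf H.
have ca c' : {within `[a, b], continuous (fun t => c' + d * t)}.
  apply: continuous_subspaceT => x.
  by apply: cvgD; [exact: cvg_cst | apply: cvgM; [exact: cvg_cst|exact: cvg_id]].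
have := @seg_int_le R f (fun t => c + e + d * t) a b cf (ca _).
have := @seg_int_le R (fun t => c - e + d * t) f a b (ca _) cf.
rewrite !seg_int_affine // => H1 H2.
rewrite ler_distl; apply/andP; split.
  apply: le_trans (H1 _); first by lra.
  by move=> t /H; rewrite ler_distl => /andP[? ?]; lra.
apply: le_trans (H2 _) _; last by lra.
by move=> t /H; rewrite ler_distl => /andP[? ?]; lra.
Qed.

Lemma seg_int_ge (R : realType) (f : R -> R) (c a b : R) :
  a <= b -> {within `[a, b], continuous f} ->
  (forall t, a <= t <= b -> c <= f t) -> c * (b - a) <= seg_int f a b.
Proof.
move=> ab cf H.
have -> : c * (b - a) = seg_int (fun t => c + 0 * t) a b.
  by rewrite seg_int_affine // !mul0r addr0.
apply: seg_int_le => //.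
  apply: continuous_subspaceT => x.
  by apply: cvgD; [exact: cvg_cst | apply: cvgM; [exact: cvg_cst|exact: cvg_id]].
by move=> t /H; rewrite mul0r addr0.
Qed.

Lemma seg_int_eq0 (R : realType) (f : R -> R) (a b : R) :
  (forall t, a <= t <= b -> f t = 0) -> seg_int f a b = 0.
Proof.
move=> H; rewrite /seg_int.
rewrite (@eq_Rintegral _ _ _ _ _ (cst 0)); first by rewrite /Rintegral /= integral0.
by move=> t; rewrite inE /= in_itv /= => /H.
Qed.

Lemma seg_intN (R : realType) (f : R -> R) (a b : R) :
  {within `[a, b], continuous f} ->
  seg_int (fun t => - f t) a b = - seg_int f a b.
Proof.
move=> cf.
have -> : (fun t => - f t) = (fun t => -1 * f t) by apply/funext => t; rewrite mulN1r.
rewrite /seg_int RintegralZl // ?mulN1r //.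
by apply: continuous_compact_integrable => //; exact: segment_compact.
Qed.

(* The flux of (u, -v) through the boundary of a rectangle; when u and v are
   the real and imaginary parts of g, the imaginary part of the contour
   integral of g. *)
Definition flux (R : realType) (u v : R -> R -> R) (x1 x2 y1 y2 : R) : R :=
  seg_int (v^~ y1) x1 x2 - seg_int (v^~ y2) x1 x2
  + seg_int (u x2) y1 y2 - seg_int (u x1) y1 y2.

(* Only one of the two Cauchy-Riemann equations, div (u, -v) = 0, is used. *)
Definition divfree_at (R : realType) (u v : R -> R -> R) (x y : R) : Prop :=
  exists a b c : R, forall e, 0 < e -> exists2 d, 0 < d &
    forall x' y', `|x' - x| < d -> `|y' - y| < d ->
      `|u x' y' - u x y - (a * (x' - x) + b * (y' - y))|
        <= e * (`|x' - x| + `|y' - y|) /\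
      `|v x' y' - v x y - (c * (x' - x) + a * (y' - y))|
        <= e * (`|x' - x| + `|y' - y|).

(** The expansion with e = 1 bounds the increments along the two axes by a constant times the
    displacement. Only continuity on horizontal and vertical lines is recorded, since the flux
    integrates over the sides of rectangles. *)
Lemma divfree_continuous (R : realType) (u v : R -> R -> R) (x y : R) :
  divfree_at u v x y ->
  [/\ {for x, continuous (u^~ y)}, {for y, continuous (u x)},
      {for x, continuous (v^~ y)} & {for y, continuous (v x)}].
Proof.
move=> [a [b [c H]]].
have H1 := H 1 ltr01; case: H1 => d d0 H1.
pose L := 1 + `|a| + `|b| + `|c|.
have L0 : 0 < L by rewrite /L; have := normr_ge0 a; have := normr_ge0 b; have := normr_ge0 c; lra.
have lip (k z e : R) : k = a \/ k = b \/ k = c -> `|z - k * e| <= 1 * `|e| -> `|z| <= L * `|e|.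
  move=> kk ze.
  have : `|z| <= `|z - k * e| + `|k| * `|e|.
    by rewrite -normrM -{1}(subrK (k * e) z) ler_normD.
  have : `|k| * `|e| <= (L - 1) * `|e|.
    apply: ler_wpM2r => //; rewrite /L.
    have := normr_ge0 a; have := normr_ge0 b; have := normr_ge0 c.
    by case: kk => [->|[->|->]]; lra.
  by move=> ? ?; lra.
have cont (f : R -> R) (t k : R) : k = a \/ k = b \/ k = c ->
    (forall t', `|t' - t| < d -> `|f t' - f t - k * (t' - t)| <= 1 * `|t' - t|) ->
    {for t, continuous f}.
  move=> kk Hf; apply/cvgrPdist_lt => e e0; near=> s.
  have sd : `|s - t| < d by near: s; apply: cvgr_distC_lt => //; exact: cvg_id.
  rewrite distrC (le_lt_trans (lip _ _ _ kk (Hf s sd))) //.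
  rewrite -ltr_pdivlMl //.
  near: s; apply: cvgr_distC_lt; first exact: cvg_id.
  by rewrite mulr_gt0 // invr_gt0.
split.
- apply: (cont _ _ a); [by left|] => t td.
  by have := H1 t y td; rewrite subrr normr0 !mulr0 !addr0 => /(_ d0)[].
- apply: (cont _ _ b); [by right; left|] => t td.
  have := H1 x t; rewrite subrr normr0 !mulr0 !add0r => /(_ d0 td)[h _].
  by [].
- apply: (cont _ _ c); [by right; right|] => t td.
  by have := H1 t y td; rewrite subrr normr0 !mulr0 !addr0 => /(_ d0)[].
- apply: (cont _ _ a); [by left|] => t td.
  by have := H1 x t; rewrite subrr normr0 !mulr0 !add0r => /(_ d0 td)[].
Unshelve. all: by end_near. Qed.

Definition divfree_on (R : realType) (u v : R -> R -> R) (x1 x2 y1 y2 : R) :=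
  forall x y, x1 <= x <= x2 -> y1 <= y <= y2 -> divfree_at u v x y.

Lemma divfree_onS (R : realType) (u v : R -> R -> R) (x1 x2 y1 y2 x3 x4 y3 y4 : R) :
  x1 <= x3 -> x4 <= x2 -> y1 <= y3 -> y4 <= y2 ->
  divfree_on u v x1 x2 y1 y2 -> divfree_on u v x3 x4 y3 y4.
Proof. by move=> ? ? ? ? H x y ? ?; apply: H; lra. Qed.

Section Flux.
Context (R : realType) (u v : R -> R -> R).

Lemma divfree_within x1 x2 y1 y2 : divfree_on u v x1 x2 y1 y2 ->
  (forall y, y1 <= y <= y2 -> {within `[x1, x2], continuous (u^~ y)} /\
     {within `[x1, x2], continuous (v^~ y)}) /\
  (forall x, x1 <= x <= x2 -> {within `[y1, y2], continuous (u x)} /\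
     {within `[y1, y2], continuous (v x)}).
Proof.
move=> H; split=> [y Hy|x Hx]; split; apply: continuous_in_subspaceT => t;
  rewrite inE /= in_itv /= => Ht.
- by have [h _ _ _] := divfree_continuous (H _ _ Ht Hy); exact: h.
- by have [_ _ h _] := divfree_continuous (H _ _ Ht Hy); exact: h.
- by have [_ h _ _] := divfree_continuous (H _ _ Hx Ht); exact: h.
- by have [_ _ _ h] := divfree_continuous (H _ _ Hx Ht); exact: h.
Qed.

Lemma flux_splitx x1 m x2 y1 y2 : x1 <= m -> m <= x2 ->
  divfree_on u v x1 x2 y1 y1 -> divfree_on u v x1 x2 y2 y2 ->
  flux u v x1 x2 y1 y2 = flux u v x1 m y1 y2 + flux u v m x2 y1 y2.
Proof.
move=> h1 h2 /divfree_within[H1 _] /divfree_within[H2 _]; rewrite /flux.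
have i1 : y1 <= y1 <= y1 by lra.
have i2 : y2 <= y2 <= y2 by lra.
rewrite (@seg_int_split _ (v^~ y1) x1 m x2) //; last by case: (H1 _ i1).
rewrite (@seg_int_split _ (v^~ y2) x1 m x2) //; last by case: (H2 _ i2).
lra.
Qed.

Lemma flux_splity x1 x2 y1 m y2 : y1 <= m -> m <= y2 ->
  divfree_on u v x1 x1 y1 y2 -> divfree_on u v x2 x2 y1 y2 ->
  flux u v x1 x2 y1 y2 = flux u v x1 x2 y1 m + flux u v x1 x2 m y2.
Proof.
move=> h1 h2 /divfree_within[_ H1] /divfree_within[_ H2]; rewrite /flux.
have i1 : x1 <= x1 <= x1 by lra.
have i2 : x2 <= x2 <= x2 by lra.
rewrite (@seg_int_split _ (u x1) y1 m y2) //; last by case: (H1 _ i1).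
rewrite (@seg_int_split _ (u x2) y1 m y2) //; last by case: (H2 _ i2).
lra.
Qed.

End Flux.

(** * Goursat's theorem for rectangles, by repeated quartering *)

Section Goursat.
Context (R : realType) (u v : R -> R -> R).

(** The affine part of (u, -v) has divergence a - a = 0, hence no flux. On each side the remainder
    is at most e times the half-perimeter D, and the sides have total length 2 D. *)
Lemma flux_small x y x1 x2 y1 y2 e d a b c :
  x1 <= x <= x2 -> y1 <= y <= y2 -> divfree_on u v x1 x2 y1 y2 ->
  (forall x' y', `|x' - x| < d -> `|y' - y| < d ->
      `|u x' y' - u x y - (a * (x' - x) + b * (y' - y))|
        <= e * (`|x' - x| + `|y' - y|) /\
      `|v x' y' - v x y - (c * (x' - x) + a * (y' - y))|
        <= e * (`|x' - x| + `|y' - y|)) -> 0 <= e ->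
  (x2 - x1) + (y2 - y1) < d ->
  `|flux u v x1 x2 y1 y2| <= 2 * e * ((x2 - x1) + (y2 - y1)) ^+ 2.
Proof.
move=> /andP[xx1 xx2] /andP[yy1 yy2] Hdf H e0 Dd.
set D := (x2 - x1) + (y2 - y1) in Dd *.
have [Hv Hh] := divfree_within Hdf.
have D0 : 0 <= D by rewrite /D; lra.
have eD x' y' : x1 <= x' <= x2 -> y1 <= y' <= y2 ->
    e * (`|x' - x| + `|y' - y|) <= e * D /\ (`|x' - x| < d /\ `|y' - y| < d).
  move=> /andP[? ?] /andP[? ?].
  have h1 : `|x' - x| <= x2 - x1 by rewrite ler_norml; lra.
  have h2 : `|y' - y| <= y2 - y1 by rewrite ler_norml; lra.
  split; last by split; rewrite /D in Dd; lra.
  by apply: ler_wpM2l => //; rewrite /D; lra.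
have Ev yy : y1 <= yy <= y2 -> `|seg_int (v^~ yy) x1 x2 -
    ((v x y - c * x + a * (yy - y)) * (x2 - x1) + c * (x2 ^+ 2 - x1 ^+ 2) / 2)|
    <= e * D * (x2 - x1).
  move=> Hyy; apply: seg_int_near_affine; [lra | by have [] := Hv _ Hyy |].
  move=> t Ht; have [h1 [h2 h3]] := eD _ _ Ht Hyy.
  have [_ h4] := H _ _ h2 h3; apply: le_trans h1; apply: le_trans h4.
  by rewrite le_eqVlt; apply/orP; left; apply/eqP; congr (`|_|); ring.
have Eh xx : x1 <= xx <= x2 -> `|seg_int (u xx) y1 y2 -
    ((u x y + a * (xx - x) - b * y) * (y2 - y1) + b * (y2 ^+ 2 - y1 ^+ 2) / 2)|
    <= e * D * (y2 - y1).
  move=> Hxx; apply: seg_int_near_affine; [lra | by have [] := Hh _ Hxx |].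
  move=> t Ht; have [h1 [h2 h3]] := eD _ _ Hxx Ht.
  have [h4 _] := H _ _ h2 h3; apply: le_trans h1; apply: le_trans h4.
  by rewrite le_eqVlt; apply/orP; left; apply/eqP; congr (`|_|); ring.
have := Ev y1; have := Ev y2; have := Eh x1; have := Eh x2.
rewrite !lexx; have -> : x1 <= x2 by lra. have -> : y1 <= y2 by lra.
move=> /(_ isT) + /(_ isT) + /(_ isT) + /(_ isT).
rewrite 4!ler_distl => /andP[? ?] /andP[? ?] /andP[? ?] /andP[? ?].
rewrite ler_norml expr2 /flux.
have -> : 2 * e * (D * D) = 2 * (e * D * (x2 - x1)) + 2 * (e * D * (y2 - y1)).
  by rewrite {2}/D; ring.
by apply/andP; split; lra.
Qed.

(* A rectangle (x1, x2, y1, y2). *)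
Definition rect := (R * R * (R * R))%type.

Definition rflux (r : rect) := flux u v r.1.1 r.1.2 r.2.1 r.2.2.
Definition rsize (r : rect) := (r.1.2 - r.1.1) + (r.2.2 - r.2.1).
Definition rbad (k : R) (r : rect) :=
  [/\ r.1.1 <= r.1.2, r.2.1 <= r.2.2, divfree_on u v r.1.1 r.1.2 r.2.1 r.2.2
    & k * rsize r ^+ 2 <= `|rflux r|].
Definition quarter (r r' : rect) :=
  [/\ r.1.1 <= r'.1.1, r'.1.2 <= r.1.2, r.2.1 <= r'.2.1, r'.2.2 <= r.2.2
    & r'.1.2 - r'.1.1 = (r.1.2 - r.1.1) / 2 /\ r'.2.2 - r'.2.1 = (r.2.2 - r.2.1) / 2].

(** The flux is additive, so one of the four quarters carries at least a quarter of it in modulus;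
    [rsize] squared drops exactly by the factor 4, and the same k survives. *)
Lemma rbad_quarter k r : rbad k r -> exists2 r', rbad k r' & quarter r r'.
Proof.
move: r => [[x1 x2] [y1 y2]] [/= xx yy df kb].
pose mx := (x1 + x2) / 2; pose my := (y1 + y2) / 2.
have [hx1 hx2] : x1 <= mx /\ mx <= x2 by rewrite /mx; lra.
have [hy1 hy2] : y1 <= my /\ my <= y2 by rewrite /my; lra.
have [ex1 ex2] : mx - x1 = (x2 - x1) / 2 /\ x2 - mx = (x2 - x1) / 2 by rewrite /mx; lra.
have [ey1 ey2] : my - y1 = (y2 - y1) / 2 /\ y2 - my = (y2 - y1) / 2 by rewrite /my; lra.
have q1 : divfree_on u v x1 mx y1 my by apply: divfree_onS df; rewrite /mx /my; lra.
have q2 : divfree_on u v x1 mx my y2 by apply: divfree_onS df; rewrite /mx /my; lra.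
have q3 : divfree_on u v mx x2 y1 my by apply: divfree_onS df; rewrite /mx /my; lra.
have q4 : divfree_on u v mx x2 my y2 by apply: divfree_onS df; rewrite /mx /my; lra.
have sp : flux u v x1 x2 y1 y2 = flux u v x1 mx y1 my + flux u v x1 mx my y2
   + (flux u v mx x2 y1 my + flux u v mx x2 my y2).
  rewrite (@flux_splitx _ _ _ x1 mx x2);
    try by [rewrite /mx; lra|apply: divfree_onS df; rewrite /mx /my; lra].
  rewrite (@flux_splity _ _ _ x1 mx y1 my y2);
    try by [rewrite /mx /my; lra|apply: divfree_onS df; rewrite /mx /my; lra].
  by rewrite (@flux_splity _ _ _ mx x2 y1 my y2) //;
    try by [rewrite /mx /my; lra|apply: divfree_onS df; rewrite /mx /my; lra].
have K (r : rect) : r.1.1 <= r.1.2 -> r.2.1 <= r.2.2 ->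
  divfree_on u v r.1.1 r.1.2 r.2.1 r.2.2 -> quarter (x1, x2, (y1, y2)) r ->
  `|flux u v x1 x2 y1 y2| <= 4 * `|rflux r| ->
  exists2 r', rbad k r' & quarter (x1, x2, (y1, y2)) r'.
  move=> h1 h2 h3 h4 h5; exists r => //; split => //.
  have : rsize (x1, x2, (y1, y2)) = 2 * rsize r.
    by case: h4 => /= _ _ _ _ [e1 e2]; rewrite /rsize /= e1 e2; field.
  move: kb; rewrite /rflux /= => kb E; move: kb; rewrite E => kb.
  rewrite -(ler_pM2l (_ : 0 < 4 :> R)) //.
  apply: le_trans h5; apply: le_trans kb; rewrite le_eqVlt; apply/orP; left; apply/eqP; ring.
have tri : `|flux u v x1 x2 y1 y2| <= `|flux u v x1 mx y1 my| + `|flux u v x1 mx my y2|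
   + (`|flux u v mx x2 y1 my| + `|flux u v mx x2 my y2|).
  by rewrite sp (le_trans (ler_normD _ _)) // lerD // ler_normD.
have [h1|h1] := leP `|flux u v x1 x2 y1 y2| (4 * `|flux u v x1 mx y1 my|).
  by apply: (K (x1, mx, (y1, my))) => //; split.
have [h2|h2] := leP `|flux u v x1 x2 y1 y2| (4 * `|flux u v x1 mx my y2|).
  by apply: (K (x1, mx, (my, y2))) => //; split.
have [h3|h3] := leP `|flux u v x1 x2 y1 y2| (4 * `|flux u v mx x2 y1 my|).
  by apply: (K (mx, x2, (y1, my))) => //; split.
have [h4|h4] := leP `|flux u v x1 x2 y1 y2| (4 * `|flux u v mx x2 my y2|).
  by apply: (K (mx, x2, (my, y2))) => //; split.
lra.
Qed.

(** Otherwise nested bad rectangles shrink to a point, where [flux_small] with e = k / 4 bounds the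
    flux by k / 2 times the squared size, against [rbad k]. *)
Lemma flux_eq0 x1 x2 y1 y2 : x1 <= x2 -> y1 <= y2 ->
  divfree_on u v x1 x2 y1 y2 -> flux u v x1 x2 y1 y2 = 0.
Proof.
move=> xx yy df; apply/eqP; apply/negPn/negP => F0.
pose r0 : rect := (x1, x2, (y1, y2)).
pose D := rsize r0.
have D0 : 0 <= D by rewrite /D /rsize /=; lra.
have Fp : 0 < `|rflux r0| by rewrite normr_gt0.
(* The added 1 keeps the denominator positive before D is known to be nonzero. *)
pose k := `|rflux r0| / (D ^+ 2 + 1).
have kp : 0 < k by rewrite /k divr_gt0 // ltr_wpDl // sqr_ge0.
have bad0 : rbad k r0.
  split=> //; rewrite /k -/D mulrAC ler_pdivrMr; last by rewrite ltr_wpDl // sqr_ge0.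
  by apply: ler_wpM2l => //; lra.
have /choice[next Hn] : forall r : {r | rbad k r},
    exists r' : {r | rbad k r}, quarter (sval r) (sval r').
  by move=> [r br]; have [r' br' q] := rbad_quarter br; exists (exist _ r' br').
pose s n := iter n next (exist _ r0 bad0).
pose X1 n := (sval (s n)).1.1; pose X2 n := (sval (s n)).1.2.
pose Y1 n := (sval (s n)).2.1; pose Y2 n := (sval (s n)).2.2.
have sq n : quarter (sval (s n)) (sval (s n.+1)) by exact: Hn.
have sb n : rbad k (sval (s n)) by case: (s n).
have X1m : {homo X1 : n m / (n <= m)%N >-> n <= m}.
  by apply: homo_leq => [//|? ? ?|n]; [exact: le_trans|case: (sq n)].
have Y1m : {homo Y1 : n m / (n <= m)%N >-> n <= m}.
  by apply: homo_leq => [//|? ? ?|n]; [exact: le_trans|case: (sq n)].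
have X2m : {homo X2 : n m / (n <= m)%N >-> m <= n}.
  by apply: (homo_leq (r := fun a b => b <= a)) => [//|? ? ? ? h|n]; [exact: le_trans h _|case: (sq n)].
have Y2m : {homo Y2 : n m / (n <= m)%N >-> m <= n}.
  by apply: (homo_leq (r := fun a b => b <= a)) => [//|? ? ? ? h|n]; [exact: le_trans h _|case: (sq n)].
have X12 n m : X1 n <= X2 m.
  apply: le_trans (X1m _ _ (leq_maxl n m)) _.
  by apply: le_trans _ (X2m _ _ (leq_maxr n m)); case: (sb (maxn n m)).
have Y12 n m : Y1 n <= Y2 m.
  apply: le_trans (Y1m _ _ (leq_maxl n m)) _.
  by apply: le_trans _ (Y2m _ _ (leq_maxr n m)); case: (sb (maxn n m)).
have supin (A B : nat -> R) : (forall n m, A n <= B m) ->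
    forall n, A n <= sup (range A) <= B n.
  move=> AB n; apply/andP; split.
    by apply: sup_upper_bound; [split; [exists (A 0%N); exists 0%N|exists (B 0%N) => _ [m _ <-]]|exists n].
  by apply: ge_sup; [exists (A 0%N); exists 0%N|move=> _ [m _ <-]].
pose x := sup (range X1); pose y := sup (range Y1).
have Hx := supin _ _ X12; have Hy := supin _ _ Y12.
have size_n n : rsize (sval (s n)) = D / 2 ^+ n.
  elim: n => [|n IH]; first by rewrite expr0 divr1.
  have [_ _ _ _ [e1 e2]] := sq n.
  rewrite /rsize e1 e2 -mulrDl -/(rsize _) IH exprS; field.
  by rewrite expf_neq0.
have [a [b [c H]]] := df _ _ (Hx 0%N) (Hy 0%N).
have [d d0 {}H] := H (k / 4) (divr_gt0 kp (ltr0n _ 4)).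
have [n Dn] := exists_half_lt D d0.
have [sb1 sb2 sb3 sb4] := sb n.
have := flux_small (Hx n) (Hy n) sb3 H (ltW (divr_gt0 kp (ltr0n _ 4))).
rewrite -/(rsize _) size_n => /(_ Dn) h.
move: sb4; rewrite size_n => sb4.
have := le_trans sb4 h.
(* A rectangle reduced to a point has flux 0; a positive size is what makes the two bounds on the
   flux incompatible. *)
have : D != 0.
  apply/eqP => E; move: F0; rewrite /D /rsize /= in E.
  have -> : x2 = x1 by lra.
  have -> : y2 = y1 by lra.
  by rewrite /flux /seg_int !set_itv1 !Rintegral_set1 subrr add0r subrr eqxx.
move=> Dn0.
have : 0 < (D / 2 ^+ n) ^+ 2 by rewrite exprn_gt0 // divr_gt0 // lt_neqAle eq_sym Dn0.
move=> p q; have : k * (D / 2 ^+ n) ^+ 2 > 0 by rewrite mulr_gt0.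
lra.
Qed.

End Goursat.

(** * The modulus, and holomorphic functions vanishing on a square *)

(** Norms over [R[i]] are complex numbers with zero imaginary part; taking the real part moves
    estimates to [R], where the order is total. *)
Definition rnorm (R : realType) (V : normedModType R[i]) (v : V) : R := complex.Re `|v|.

Section Rnorm.
Context (R : realType).
Implicit Types (V : normedModType R[i]) (x y z : R[i]).

Lemma rnormE V (v : V) : `|v| = (rnorm v)%:C%C.
Proof. by rewrite /rnorm RRe_real // normr_real. Qed.

Lemma rnorm_ge0 V (v : V) : 0 <= rnorm v.
Proof. by rewrite -ler0c -rnormE. Qed.

Lemma rnormD V (v w : V) : rnorm (v + w) <= rnorm v + rnorm w.
Proof. by rewrite -lecR rmorphD /= -!rnormE ler_normD. Qed.

Lemma rnormN V (v : V) : rnorm (- v) = rnorm v.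
Proof. by rewrite /rnorm normrN. Qed.

Lemma rnormB V (v w : V) : rnorm (v - w) <= rnorm v + rnorm w.
Proof. by rewrite -(rnormN w) rnormD. Qed.

Lemma rnormC V (v w : V) : rnorm (v - w) = rnorm (w - v).
Proof. by rewrite -rnormN opprB. Qed.

Lemma rnorm0 V : rnorm (0 : V) = 0.
Proof. by rewrite /rnorm normr0. Qed.

Lemma rnorm_eq0 V (v : V) : rnorm v = 0 -> v = 0.
Proof. by move=> v0; apply/normr0_eq0; rewrite rnormE v0. Qed.

Lemma rnormZ V (a : R[i]) (v : V) : rnorm (a *: v) = rnorm a * rnorm v.
Proof.
by apply/complexI; rewrite rmorphM /= -!rnormE normrZ.
Qed.

Lemma rnormM x y : rnorm (x * y) = rnorm x * rnorm y.
Proof. by apply/complexI; rewrite rmorphM /= -!rnormE normrM. Qed.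

Lemma rnorm1 : rnorm (1 : R[i]) = 1.
Proof. by rewrite /rnorm normr1. Qed.

Lemma rnormX x n : rnorm (x ^+ n) = rnorm x ^+ n.
Proof. by elim: n => [|n IH]; rewrite ?expr0 ?rnorm1 // !exprS rnormM IH. Qed.

Lemma rnormV x : rnorm x^-1 = (rnorm x)^-1.
Proof. by apply/complexI; rewrite fmorphV /= -!rnormE normfV. Qed.

Lemma rnormR (a : R) : rnorm (a%:C%C : R[i]) = `|a|.
Proof. by rewrite /rnorm normc_def /= expr0n /= addr0 sqrtr_sqr. Qed.

Lemma Re_rnorm x : `|complex.Re x| <= rnorm x.
Proof.
by rewrite /rnorm normc_def /= -sqrtr_sqr ler_wsqrtr // lerDl sqr_ge0.
Qed.

Lemma Im_rnorm x : `|complex.Im x| <= rnorm x.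
Proof.
by rewrite /rnorm normc_def /= -sqrtr_sqr ler_wsqrtr // lerDr sqr_ge0.
Qed.

Lemma rnorm_ReIm x : rnorm x <= `|complex.Re x| + `|complex.Im x|.
Proof.
rewrite {1}[x]complexE (le_trans (rnormD _ _)) // rnormM !rnormR.
by rewrite /rnorm normc_def /= expr0n expr1n /= add0r sqrtr1 mul1r.
Qed.

Lemma rnorm_gt0 V (v : V) : v != 0 -> 0 < rnorm v.
Proof.
by move=> v0; rewrite lt_neqAle rnorm_ge0 andbT eq_sym; apply: contra v0 => /eqP/rnorm_eq0 ->.
Qed.

Lemma complex_gt0E (e : R[i]) : 0 < e -> e = (complex.Re e)%:C%C /\ 0 < complex.Re e.
Proof. by case: e => a b; rewrite ltcE /= => /andP[/eqP -> ->]. Qed.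

Lemma nbhs_rnormP V (x : V) (P : set V) : nbhs x P <->
  exists2 e : R, 0 < e & forall y : V, rnorm (y - x) < e -> P y.
Proof.
split=> [/nbhs_normP[e /= e0 H]|[e e0 H]].
  have [eE e0'] := complex_gt0E e0; exists (complex.Re e) => // y yx; apply: H => /=.
  by rewrite distrC eE rnormE ltcR.
apply/nbhs_normP; exists (e%:C)%C => /=; first by rewrite ltcR.
by move=> y /=; rewrite distrC rnormE ltcR => /H.
Qed.

Lemma differentiable_rnormP V (f : V -> R[i]) (x : V) : differentiable f x ->
  exists L : {linear V -> R[i]}, forall e : R, 0 < e -> exists2 d, 0 < d &
    forall h, rnorm h < d -> rnorm (f (x + h) - f x - L h) <= e * rnorm h.
Proof.
move=> df; exists ('d f x) => e e0.
have /eqaddoP := diff_locally df.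
move=> /(_ (e%:C)%C); rewrite ltcR => /(_ e0) /nbhs_rnormP[d d0 H].
exists d => // h hd; have := H h; rewrite subr0 => /(_ hd) /=.
rewrite !rnormE -rmorphM lecR /=; congr (_ <= _); congr rnorm.
by rewrite /= !fctE /= opprD addrA [h + x]addrC.
Qed.

(** The linear bound makes L continuous and the quadratic remainder is o(h), so L is the
    differential. C may have any sign, hence the denominators [|C| + 1]. *)
Lemma rnorm_differentiable V (f : V -> R[i]) (x : V) (L : {linear V -> R[i]}) C r :
  0 < r ->
  (forall h, rnorm (L h) <= C * rnorm h) ->
  (forall h, rnorm h <= r -> rnorm (f (x + h) - f x - L h) <= C * rnorm h ^+ 2) ->
  differentiable f x.
Proof.
move=> r0 HL H.
have C0 : 0 <= `|C| by [].
have HC (h : V) k : C * rnorm h ^+ k <= `|C| * rnorm h ^+ k.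
  by apply: ler_wpM2r; [rewrite exprn_ge0 // rnorm_ge0 | rewrite ler_norm].
have cL : continuous L.
  move=> y P /nbhs_rnormP[e e0 He]; apply/nbhs_rnormP.
  exists (e / (`|C| + 1)); first by rewrite divr_gt0 // ltr_wpDl.
  move=> z; rewrite ltr_pdivlMr; last by rewrite ltr_wpDl.
  move=> zy; apply: He; rewrite -linearB; apply: le_lt_trans (HL _) _.
  have := HC (z - y) 1%N; rewrite expr1 => h; apply: le_lt_trans h _.
  by apply: le_lt_trans zy; rewrite mulrC ler_wpM2l ?rnorm_ge0 // lerDl.
have dL : f \o shift x = cst (f x) + L +o_ 0 id.
  apply/eqaddoP => e /complex_gt0E[-> e0].
  apply/nbhs_rnormP; exists (Order.min r (complex.Re e / (`|C| + 1))).
    by rewrite lt_min r0 divr_gt0 // ltr_wpDl.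
  move=> h; rewrite subr0 lt_min ltr_pdivlMr => [/andP[h1 h2]|]; last by rewrite ltr_wpDl.
  rewrite !rnormE -rmorphM lecR /=.
  have -> : rnorm ((f \o shift x - (cst (f x) + L)) h) = rnorm (f (x + h) - f x - L h).
    by congr rnorm; rewrite !fctE /= opprD addrA [h + x]addrC.
  apply: le_trans (H _ (ltW h1)) _; apply: le_trans (HC _ _) _.
  rewrite expr2 mulrA; apply: ler_wpM2r; first exact: rnorm_ge0.
  apply: le_trans (ltW h2); rewrite mulrC ler_wpM2l ?rnorm_ge0 // lerDl //.
apply/diff_locallyP; rewrite (diff_unique cL dL); split => //.
Qed.

Lemma differentiable_rnorm_cont V (f : V -> R[i]) (x : V) : differentiable f x ->
  forall e : R, 0 < e -> exists2 d, 0 < d &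
    forall y : V, rnorm (y - x) < d -> rnorm (f y - f x) < e.
Proof.
move=> /differentiable_continuous cf e e0.
have : nbhs (f x) [set t | rnorm (t - f x) < e] by apply/nbhs_rnormP; exists e.
by move=> /cf /nbhs_rnormP[d d0 H]; exists d.
Qed.

Lemma rnorm_dist V (v w : V) :
  `|rnorm v - rnorm w| <= rnorm (v - w).
Proof.
rewrite ler_norml; apply/andP; split.
  by have := rnormB v (v - w); rewrite opprB addrC subrK; lra.
by have := rnormD (v - w) w; rewrite subrK; lra.
Qed.

Lemma open_ball_rnorm V (x : V) (r : R) :
  open [set y : V | rnorm (y - x) < r].
Proof.
rewrite openE => y /= yr; apply/nbhs_rnormP; exists (r - rnorm (y - x)).
  by rewrite subr_gt0.
move=> z; rewrite ltrBrDr => h; apply: le_lt_trans h.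
by have := rnormD (z - y) (y - x); rewrite addrA subrK.
Qed.

Lemma rnorm_pair V (W : normedModType R[i]) (z : V) (w : W) :
  rnorm (z, w) = Order.max (rnorm z) (rnorm w).
Proof.
apply/complexI; rewrite -rnormE prod_normE /= !rnormE.
have [h|h] := leP (rnorm z) (rnorm w).
  by rewrite max_r // lecR.
by rewrite max_l // lecR ltW.
Qed.

End Rnorm.

(** * Holomorphic functions vanishing on the boundary of a square *)

Section SquareUniqueness.
Context (R : realType).
Local Open Scope complex_scope.

(** A complex linear L is multiplication by l = L 1. The real part of l h has gradient (Re l, - Im
    l), the imaginary part (Im l, Re l): the coefficient Re l is common to both. *)
Lemma divfree_differentiable (g : R[i] -> R[i]) (x y : R) :
  differentiable g (x +i* y) ->
  divfree_at (fun x y => complex.Re (g (x +i* y)))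
    (fun x y => complex.Im (g (x +i* y))) x y.
Proof.
move=> /differentiable_rnormP[L H].
pose l := L 1.
exists (complex.Re l), (- complex.Im l), (complex.Im l) => e e0.
have [d d0 {}H] := H e e0; exists (d / 2) => [|x' y' xd yd]; first exact: divr_gt0.
pose h : R[i] := (x' - x) +i* (y' - y).
have hn : rnorm h <= `|x' - x| + `|y' - y| by have := rnorm_ReIm h.
have hd : rnorm h < d by apply: le_lt_trans hn _; lra.
have Lh : L h = h * l by rewrite -[h in L h]mulr1 -[h * 1]/(h *: 1) linearZ.
have xh : x +i* y + h = x' +i* y' by rewrite /h; simpc; congr (_ +i* _); ring.
have := H h hd; rewrite xh Lh => K.
have K' : rnorm (g (x' +i* y') - g (x +i* y) - h * l) <= e * (`|x' - x| + `|y' - y|).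
  by apply: le_trans K _; apply: ler_wpM2l => //; exact: ltW.
split; apply: le_trans K'.
  apply: le_trans (Re_rnorm _); rewrite le_eqVlt; apply/orP; left; apply/eqP.
  congr (`|_|); rewrite /h; move: (g (x +i* y)) (g (x' +i* y')) (l) => [? ?] [? ?] [? ?] /=.
  by ring.
apply: le_trans (Im_rnorm _); rewrite le_eqVlt; apply/orP; left; apply/eqP.
congr (`|_|); rewrite /h; move: (g (x +i* y)) (g (x' +i* y')) (l) => [? ?] [? ?] [? ?] /=.
by ring.
Qed.

(** The part of the large rectangle outside the small one is cut into four rectangles that miss (x0,
    y0), and [flux_eq0] applies to each. *)
Lemma flux_annulus (u v : R -> R -> R) (X1 x1 x0 x2 X2 Y1 y1 y0 y2 Y2 : R) :
  X1 <= x1 -> x1 < x0 -> x0 < x2 -> x2 <= X2 ->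
  Y1 <= y1 -> y1 < y0 -> y0 < y2 -> y2 <= Y2 ->
  (forall x y, X1 <= x <= X2 -> Y1 <= y <= Y2 -> x != x0 \/ y != y0 ->
     divfree_at u v x y) ->
  flux u v X1 X2 Y1 Y2 = flux u v x1 x2 y1 y2.
Proof.
move=> hX1 hx1 hx2 hX2 hY1 hy1 hy2 hY2 dh.
have [hx12 hy12] : x1 <= x2 /\ y1 <= y2 by split; lra.
have dx x3 x4 y3 y4 : X1 <= x3 -> x4 <= X2 -> Y1 <= y3 -> y4 <= Y2 ->
    (x4 < x0) || (x0 < x3) -> divfree_on u v x3 x4 y3 y4.
  move=> ? ? ? ? ne x y /andP[? ?] /andP[? ?].
  apply: dh; [apply/andP; split; lra|apply/andP; split; lra|left].
  by case/orP: ne => ?; apply/eqP; lra.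
have dy x3 x4 y3 y4 : X1 <= x3 -> x4 <= X2 -> Y1 <= y3 -> y4 <= Y2 ->
    (y4 < y0) || (y0 < y3) -> divfree_on u v x3 x4 y3 y4.
  move=> ? ? ? ? ne x y /andP[? ?] /andP[? ?].
  apply: dh; [apply/andP; split; lra|apply/andP; split; lra|right].
  by case/orP: ne => ?; apply/eqP; lra.
clear dh.
have z2 : flux u v X1 x1 Y1 Y2 = 0.
  by apply: flux_eq0; [lra|lra|apply: dx; lra].
have z3 : flux u v x2 X2 Y1 Y2 = 0.
  by apply: flux_eq0; [lra|lra|apply: dx; lra].
have z4 : flux u v x1 x2 Y1 y1 = 0.
  by apply: flux_eq0; [lra|lra|apply: dy; lra].
have z5 : flux u v x1 x2 y2 Y2 = 0.
  by apply: flux_eq0; [lra|lra|apply: dy; lra].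
rewrite (@flux_splitx _ _ _ X1 x1 X2); [|lra|lra|apply: dy; lra|apply: dy; lra].
rewrite (@flux_splitx _ _ _ x1 x2 X2); [|lra|lra|apply: dy; lra|apply: dy; lra].
rewrite (@flux_splity _ _ _ x1 x2 Y1 y1 Y2); [|lra|lra|apply: dx; lra|apply: dx; lra].
rewrite (@flux_splity _ _ _ x1 x2 y1 y2 Y2); [|lra|lra|apply: dx; lra|apply: dx; lra].
by rewrite z2 z3 z4 z5 !add0r !addr0.
Qed.

(** The integrand on a side at distance s from the pole, c being the position along the side: the
    numerator is at least 7/8 s - 1/8 s, the denominator at most 2 s^2. *)
Lemma cauchy_kernel_ge (s a b c : R) : 0 < s -> `|c| <= s -> 7 / 8 <= a ->
  `|b| <= 1 / 8 -> 3 / (8 * s) <= (a * s + b * c) / (c ^+ 2 + s ^+ 2).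
Proof.
move=> s0 cs ha hb.
have p : 0 < c ^+ 2 + s ^+ 2 by rewrite ltr_wpDl ?sqr_ge0 ?exprn_gt0.
rewrite ler_pdivlMr // mulrAC ler_pdivrMr ?mulr_gt0 //.
have bc : `|b * c| <= 1 / 8 * s by rewrite normrM; apply: ler_pM.
have cc : c ^+ 2 <= s ^+ 2.
  by rewrite -real_normK ?num_real // lerXn2r ?nnegrE // ltW.
move: bc; rewrite ler_norml => /andP[bc _].
have ss : a * s >= 7 / 8 * s by rewrite ler_wpM2r // ltW.
have : 6 / 8 * s <= a * s + b * c by lra.
move=> k1; have : 6 / 8 * s * (8 * s) <= (a * s + b * c) * (8 * s).
  by apply: ler_wpM2r => //; rewrite mulr_ge0 // ltW.
by clear -cc; rewrite !expr2 in cc *; lra.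
Qed.

(* Near a point where q = a + ib is close to 1, the flux of q / (z - z0) through
   a small square around z0 is positive. *)
Lemma flux_pole_gt0 (u v : R -> R -> R) (x0 y0 s : R) : 0 < s ->
  (forall x y, `|x - x0| <= s -> `|y - y0| <= s -> x != x0 \/ y != y0 ->
     divfree_at u v x y) ->
  (forall x y, `|x - x0| <= s -> `|y - y0| <= s -> exists a b,
    [/\ 7 / 8 <= a, `|b| <= 1 / 8,
     u x y = (a * (x - x0) + b * (y - y0)) / ((x - x0) ^+ 2 + (y - y0) ^+ 2)
   & v x y = (b * (x - x0) - a * (y - y0)) / ((x - x0) ^+ 2 + (y - y0) ^+ 2)]) ->
  0 < flux u v (x0 - s) (x0 + s) (y0 - s) (y0 + s).
Proof.
move=> s0 dc hf.
have dX x : `|x - x0| = s -> divfree_on u v x x (y0 - s) (y0 + s).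
  move=> xs x' y' /le_anti <- ?.
  apply: dc; [by rewrite xs|by rewrite ler_distl|left].
  by rewrite -subr_eq0 -normr_gt0 xs.
have dY y : `|y - y0| = s -> divfree_on u v (x0 - s) (x0 + s) y y.
  move=> ys x' y' ? /le_anti <-.
  apply: dc; [by rewrite ler_distl|by rewrite ys|right].
  by rewrite -subr_eq0 -normr_gt0 ys.
have e1 z : `|z - s - z| = s by rewrite addrAC subrr sub0r normrN gtr0_norm.
have e2 z : `|z + s - z| = s by rewrite addrAC subrr add0r gtr0_norm.
have c0 : 0 < 3 / (8 * s) * (2 * s) by rewrite mulr_gt0 ?divr_gt0 ?mulr_gt0.
have i0 z : z - s <= z + s by rewrite lerD2l; apply: le_trans (ltW s0); rewrite oppr_le0 ltW.
have len z : z + s - (z - s) = 2 * s by ring.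
have [_ /(_ (x0 - s))] := divfree_within (dX _ (e1 _)); rewrite lexx => /(_ isT)[cu1 _].
have [_ /(_ (x0 + s))] := divfree_within (dX _ (e2 _)); rewrite lexx => /(_ isT)[cu2 _].
have [/(_ (y0 - s)) + _] := divfree_within (dY _ (e1 _)); rewrite lexx => /(_ isT)[_ cv1].
have [/(_ (y0 + s)) + _] := divfree_within (dY _ (e2 _)); rewrite lexx => /(_ isT)[_ cv2].
have cN (f : R -> R) a b : {within `[a, b], continuous f} ->
    {within `[a, b], continuous (fun t => - f t)}.
  by move=> cf t; apply: cvgN; exact: cf.
have l1 : 3 / (8 * s) * (2 * s) <= seg_int (v^~ (y0 - s)) (x0 - s) (x0 + s).
  rewrite -(len x0); apply: (seg_int_ge (i0 x0) cv1) => t; rewrite -ler_distl => ts.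
  have [||a [b [ha hb _ ->]]] := hf t (y0 - s) => //; first by rewrite e1.
  have := cauchy_kernel_ge s0 ts ha hb; congr (_ <= _ / _); ring.
have l2 : 3 / (8 * s) * (2 * s) <= seg_int (u (x0 + s)) (y0 - s) (y0 + s).
  rewrite -(len y0); apply: (seg_int_ge (i0 y0) cu2) => t; rewrite -ler_distl => ts.
  have [||a [b [ha hb -> _]]] := hf (x0 + s) t => //; first by rewrite e2.
  have := cauchy_kernel_ge s0 ts ha hb; congr (_ <= _ / _); ring.
have l3 : 3 / (8 * s) * (2 * s) <= - seg_int (v^~ (y0 + s)) (x0 - s) (x0 + s).
  rewrite -(len x0) -seg_intN //; apply: (seg_int_ge (i0 x0) (cN _ _ _ cv2)) => t.
  rewrite -ler_distl => ts.
  have [||a [b [ha hb _ ->]]] := hf t (y0 + s) => //; first by rewrite e2.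
  rewrite -normrN in hb; have := cauchy_kernel_ge s0 ts ha hb.
  rewrite -mulNr; congr (_ <= _ / _); ring.
have l4 : 3 / (8 * s) * (2 * s) <= - seg_int (u (x0 - s)) (y0 - s) (y0 + s).
  rewrite -(len y0) -seg_intN //; apply: (seg_int_ge (i0 y0) (cN _ _ _ cu1)) => t.
  rewrite -ler_distl => ts.
  have [||a [b [ha hb -> _]]] := hf (x0 - s) t => //; first by rewrite e1.
  rewrite -normrN in hb; have := cauchy_kernel_ge s0 ts ha hb.
  rewrite -mulNr; congr (_ <= _ / _); ring.
rewrite /flux; clear -l1 l2 l3 l4 c0; lra.
Qed.

Lemma pole_ReIm (q : R[i]) (a b : R) :
  complex.Re (q * (a +i* b)^-1)
    = (complex.Re q * a + complex.Im q * b) / (a ^+ 2 + b ^+ 2) /\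
  complex.Im (q * (a +i* b)^-1)
    = (complex.Im q * a - complex.Re q * b) / (a ^+ 2 + b ^+ 2).
Proof. by case: q => c d /=; split; ring. Qed.

Lemma rnorm_sub1 (q : R[i]) (e : R) : rnorm (q - 1) <= e ->
  1 - e <= complex.Re q /\ `|complex.Im q| <= e.
Proof.
move=> q1; have := le_trans (Re_rnorm _) q1; have := le_trans (Im_rnorm _) q1.
case: q {q1} => a b; simpc => /= hb; rewrite ler_norml => /andP[ha _].
by split => //; lra.
Qed.

(** If g(al) were nonzero, g(t) / (g(al) (t - al)) would have flux 0 through the boundary, where g
    vanishes. That flux equals the one through a small square around al, where g / g(al) is within
    1/8 of 1, and the latter is positive by [flux_pole_gt0]. *)
Lemma square_uniqueness (g : R[i] -> R[i]) (r : R) : 0 < r ->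
  (forall x y, `|x| <= r -> `|y| <= r -> differentiable g (x +i* y)) ->
  (forall x y, `|x| <= r -> `|y| <= r -> `|x| = r \/ `|y| = r ->
     g (x +i* y) = 0) ->
  forall x y, `|x| <= r -> `|y| <= r -> g (x +i* y) = 0.
Proof.
move=> r0 dg bg x0 y0 x0r y0r.
have [xr|xr] := eqVneq `|x0| r; first by apply: bg => //; left.
have [yr|yr] := eqVneq `|y0| r; first by apply: bg => //; right.
have {}xr : `|x0| < r by rewrite lt_neqAle xr.
have {}yr : `|y0| < r by rewrite lt_neqAle yr.
apply/eqP; apply/negPn/negP => g0.
set al := x0 +i* y0 in g0.
pose h t := g t * (g al * (t - al))^-1.
pose u x y := complex.Re (h (x +i* y)).
pose v x y := complex.Im (h (x +i* y)).
have dh x y : `|x| <= r -> `|y| <= r -> x != x0 \/ y != y0 -> divfree_at u v x y.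
  move=> xr' yr' ne; apply: divfree_differentiable.
  apply: (differentiableM (dg x y xr' yr')); apply: differentiableV.
    apply: (differentiableM (differentiable_cst _ _)).
    apply: (differentiableB _ (differentiable_cst _ _)).
    exact: ex_diff.
  rewrite mulf_neq0 // subr_eq0 eq_complex /= negb_and.
  by case: ne => ->; rewrite ?orbT.
have [s s0 [Hs [s1 s2 s3 s4]]] : exists2 s, 0 < s &
    (forall x y, `|x - x0| <= s -> `|y - y0| <= s ->
       rnorm (g (x +i* y) - g al) <= rnorm (g al) / 8) /\
    [/\ - r <= x0 - s, x0 + s <= r, - r <= y0 - s & y0 + s <= r].
  have [|d d0 H] := @differentiable_rnorm_cont _ _ g al (dg _ _ x0r y0r) (rnorm (g al) / 8).
    by rewrite divr_gt0 // rnorm_gt0.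
  pose m := Order.min (d / 4) (Order.min (r - `|x0|) (r - `|y0|)).
  have m0 : 0 < m by rewrite /m !lt_min divr_gt0 //= !subr_gt0 xr.
  have : m <= m by [].
  rewrite {2}/m !le_min => /and3P[m1 m2 m3].
  exists (m / 2); first by rewrite divr_gt0.
  split; last first.
    have [a1 a2 a3 a4] : [/\ x0 <= `|x0|, - x0 <= `|x0|, y0 <= `|y0| & - y0 <= `|y0|].
      by split; rewrite ?ler_norm // -normrN ler_norm.
    by clear -m0 m2 m3 a1 a2 a3 a4; split; lra.
  move=> x y hx hy; apply: ltW; apply: H; apply: le_lt_trans (rnorm_ReIm _) _.
  rewrite /al; simpc => /=; apply: le_lt_trans (lerD hx hy) _.
  by clear -m0 m1 d0; lra.
have : flux u v (- r) r (- r) r = 0.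
  have h0 x y : `|x| <= r -> `|y| <= r -> `|x| = r \/ `|y| = r -> h (x +i* y) = 0.
    by move=> ? ? ?; rewrite /h bg // mul0r.
  rewrite /flux !seg_int_eq0 ?subrr ?addr0 ?subr0 // => t tr;
  rewrite /u /v h0 ?normrN ?(gtr0_norm r0) ?ler_norml //; by [left|right].
rewrite (@flux_annulus u v (- r) (x0 - s) x0 (x0 + s) r (- r) (y0 - s) y0 (y0 + s) r) //;
  rewrite ?ltrDl ?ltrBlDr ?ltrDl //; last first.
  by move=> x y hx hy ne; apply: dh; rewrite ?ler_norml.
apply/eqP; rewrite gt_eqF //; apply: flux_pole_gt0 => //.
  move=> x y; rewrite !ler_distl => /andP[h1 h2] /andP[h3 h4] ne.
  apply: dh => //; rewrite ler_norml; apply/andP; split;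
    by [apply: le_trans h1|apply: le_trans s2|apply: le_trans h3|apply: le_trans s4].
move=> x y hx hy; have := Hs x y hx hy; set t := g (x +i* y) => tH.
pose q := t / g al; exists (complex.Re q), (complex.Im q).
have q1 : rnorm (q - 1) <= 1 / 8.
  have -> : q - 1 = (t - g al) / g al by rewrite /q; field.
  by rewrite rnormM rnormV ler_pdivrMr ?rnorm_gt0 // mul1r mulrC.
have hq : h (x +i* y) = q * ((x - x0) +i* (y - y0))^-1.
  by rewrite /h -/t invfM mulrA /q /al; congr (_ * _^-1); simpc.
have [h1 h2] := rnorm_sub1 q1.
have [h3 h4] := pole_ReIm q (x - x0) (y - y0).
split=> //; last 2 first.
- exact: etrans (congr1 _ hq) h3.
- exact: etrans (congr1 _ hq) h4.
by apply: le_trans h1; clear; lra.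
Qed.

End SquareUniqueness.

(** * The polynomials theta_n *)

(* (c, [:: b1; ...; bn]) stands for the polynomial c (t - b1) ... (t - bn). *)
Definition lfac (R : realType) := (R[i] * seq R[i])%type.

HB.lock Definition lev (R : realType) (f : lfac R) (t : R[i]) : R[i] :=
  f.1 * \prod_(b <- f.2) (t - b).

(** A majorant of the modulus of [lev f] on the disc of radius M that is multiplicative in the
    factors, so that it follows the recursion [lstep]. *)
HB.lock Definition lnorm (R : realType) (M : R) (f : lfac R) : R :=
  rnorm f.1 * \prod_(b <- f.2) (M + rnorm b).

Section LinearFactors.
Context (R : realType).
Local Notation C := (R[i]).
Implicit Types (f : lfac R) (M : R).

Definition lstep (c : C) (k : nat) (b : C) (f : lfac R) : lfac R :=
  (c * f.1 ^+ k, b :: flatten (nseq k f.2)).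

Lemma prod_flatten_nseq (T : comPzRingType) (F : C -> T) k s :
  \prod_(b <- flatten (nseq k s)) F b = (\prod_(b <- s) F b) ^+ k.
Proof.
by elim: k => [|k IH]; rewrite ?big_nil ?expr0 //= big_cat /= IH exprS.
Qed.

Lemma lev_step c k b f t : lev (lstep c k b f) t = c * lev f t ^+ k * (t - b).
Proof. by rewrite lev.unlock /= big_cons prod_flatten_nseq exprMn; ring. Qed.

Lemma lnorm_step M c k b f :
  lnorm M (lstep c k b f) = rnorm c * lnorm M f ^+ k * (M + rnorm b).
Proof.
by rewrite lnorm.unlock /= big_cons prod_flatten_nseq rnormM rnormX exprMn; ring.
Qed.

Lemma lnorm_ge0 M f : 0 <= M -> 0 <= lnorm M f.
Proof.
move=> M0; rewrite lnorm.unlock mulr_ge0 ?rnorm_ge0 //.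
by apply: prodr_ge0 => b _; rewrite addr_ge0 ?rnorm_ge0.
Qed.

Lemma lnorm_le M M' f : 0 <= M -> M <= M' -> lnorm M f <= lnorm M' f.
Proof.
move=> M0 MM; rewrite lnorm.unlock ler_wpM2l ?rnorm_ge0 //.
by apply: ler_prod => b _; rewrite addr_ge0 ?rnorm_ge0 //= lerD2r.
Qed.

(** Induction on the roots by the product rule. Since |t| is at most M - 1, the old factor t - b
    costs M - 1 + |b|, and the missing 1 pays for the term in which the factor itself varies; one
    majorant thus serves all three bounds. *)
Lemma lev_taylor M f t : rnorm t <= M - 1 -> exists2 d, rnorm d <= lnorm M f &
  forall h, rnorm h <= 1 ->
    [/\ rnorm (lev f (t + h)) <= lnorm M f,
        rnorm (lev f (t + h) - lev f t) <= lnorm M f * rnorm h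
      & rnorm (lev f (t + h) - lev f t - h * d) <= lnorm M f * rnorm h ^+ 2].
Proof.
move=> tM; case: f => c s.
have M1 : 0 <= M by have := rnorm_ge0 t; lra.
elim: s => [|b s [d dl IH]].
  rewrite lev.unlock lnorm.unlock !big_nil !mulr1 /=; exists 0; first by rewrite rnorm0 rnorm_ge0.
  by move=> h h1; rewrite !big_nil !mulr1 subrr mulr0 subr0 rnorm0 lexx !mulr_ge0 ?exprn_ge0 ?rnorm_ge0.
have evS u : lev (c, b :: s) u = (u - b) * lev (c, s) u.
  by rewrite lev.unlock /= big_cons; ring.
have nS : lnorm M (c, b :: s) = (M + rnorm b) * lnorm M (c, s).
  by rewrite lnorm.unlock /= big_cons; ring.
have L0 := lnorm_ge0 (c, s) M1; set L := lnorm M (c, s) in L0 nS dl IH.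
have tb : rnorm (t - b) <= M - 1 + rnorm b by apply: le_trans (rnormB _ _) _; rewrite lerD2r.
have [|_ _ _] := IH 0; first by rewrite rnorm0.
have e0 : rnorm (lev (c, s) t) <= L by have [|+ _ _] := IH 0; rewrite ?rnorm0 ?addr0.
rewrite nS; exists (lev (c, s) t + (t - b) * d).
  apply: le_trans (rnormD _ _) _; rewrite (rnormM (t - b)).
  apply: le_trans (lerD e0 (ler_pM (rnorm_ge0 _) (rnorm_ge0 _) tb dl)) _.
  by rewrite le_eqVlt; apply/orP; left; apply/eqP; ring.
move=> h h1; have [i1 i2 i3] := IH h h1; rewrite !evS.
have hp := rnorm_ge0 h.
split.
- rewrite (rnormM (t + h - b)); apply: ler_pM; rewrite ?rnorm_ge0 //.
  have -> : t + h - b = (t - b) + h by ring.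
  by apply: le_trans (rnormD _ _) _; lra.
- have -> : (t + h - b) * lev (c, s) (t + h) - (t - b) * lev (c, s) t =
    (t - b) * (lev (c, s) (t + h) - lev (c, s) t) + h * lev (c, s) (t + h) by ring.
  apply: le_trans (rnormD _ _) _; rewrite (rnormM (t - b)) (rnormM h).
  apply: le_trans (lerD (ler_pM (rnorm_ge0 _) (rnorm_ge0 _) tb i2)
    (ler_wpM2l hp i1)) _.
  by rewrite le_eqVlt; apply/orP; left; apply/eqP; ring.
- have -> : (t + h - b) * lev (c, s) (t + h) - (t - b) * lev (c, s) t
      - h * (lev (c, s) t + (t - b) * d) =
    (t - b) * (lev (c, s) (t + h) - lev (c, s) t - h * d)
    + h * (lev (c, s) (t + h) - lev (c, s) t) by ring.
  apply: le_trans (rnormD _ _) _; rewrite (rnormM (t - b)) (rnormM h).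
  apply: le_trans (lerD (ler_pM (rnorm_ge0 _) (rnorm_ge0 _) tb i3)
    (ler_wpM2l hp i2)) _.
  by rewrite le_eqVlt; apply/orP; left; apply/eqP; ring.
Qed.

Lemma lev_le M f t : rnorm t <= M -> rnorm (lev f t) <= lnorm M f.
Proof.
move=> tM; rewrite lev.unlock lnorm.unlock rnormM ler_wpM2l ?rnorm_ge0 //.
elim: f.2 => [|b s IH]; first by rewrite !big_nil rnorm1.
rewrite !big_cons rnormM; apply: ler_pM; rewrite ?rnorm_ge0 //.
by apply: le_trans (rnormB _ _) _; rewrite lerD2r.
Qed.

Lemma exists_pow2_ge (x : R) : exists k, x <= 2 ^+ k.
Proof. by exists (Num.bound x); rewrite ltW // upper_nthrootP. Qed.

(* The estimate making the products [lev f a1 * lev f a2] summable against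
   the values of f on the disc of radius M. *)
Definition lsmall (M : R) (n : nat) (f : lfac R) (a1 a2 : C) : Prop :=
  rnorm (lev f a1 * lev f a2) * lnorm M f ^+ 2 <= 2^-1 ^+ n.+1.

(** A step replaces the quantity y of [lsmall] by at most |c|^4 (n + 1 + |b|)^4 y^k. As y is at most
    1/2, the factor 2^-k absorbs the constants and leaves 2^-(n + 2). *)
Lemma lsmall_step M n c k b f a1 a2 : 0 <= M -> M <= n.+1%:R ->
  rnorm c ^+ 4 * (n.+1%:R + rnorm b) ^+ 4 * 2 ^+ n.+2 <= 2 ^+ k ->
  rnorm a1 <= M -> rnorm a2 <= M ->
  lsmall M n f a1 a2 -> lsmall M n.+1 (lstep c k b f) a1 a2.
Proof.
move=> M0 Mn hk h1 h2; rewrite /lsmall !lev_step lnorm_step => H.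
set x := lev f a1 * lev f a2 in H.
have -> : c * lev f a1 ^+ k * (a1 - b) * (c * lev f a2 ^+ k * (a2 - b)) =
  c ^+ 2 * x ^+ k * ((a1 - b) * (a2 - b)) by rewrite /x (exprMn _ (lev f a1)); ring.
rewrite (rnormM (c ^+ 2 * x ^+ k)) (rnormM (c ^+ 2)) (rnormM (a1 - b)) !rnormX.
set y := rnorm x * lnorm M f ^+ 2 in H.
have y0 : 0 <= y by rewrite /y mulr_ge0 ?rnorm_ge0 ?exprn_ge0 ?lnorm_ge0.
have hab : rnorm (a1 - b) * rnorm (a2 - b) <= (n.+1%:R + rnorm b) ^+ 2.
  by rewrite expr2; apply: ler_pM; rewrite ?rnorm_ge0 //;
     apply: le_trans (rnormB _ _) _; rewrite lerD2r; apply: le_trans Mn.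
have hM : (M + rnorm b) ^+ 2 <= (n.+1%:R + rnorm b) ^+ 2.
  by rewrite lerXn2r ?nnegrE ?addr_ge0 ?rnorm_ge0 // lerD2r.
have yk : y ^+ k <= 2^-1 ^+ k.
  apply: lerXn2r; rewrite ?nnegrE ?invr_ge0 //; apply: le_trans H _.
  by rewrite exprS ler_piMr // exprn_ile1 //; lra.
have -> : rnorm c ^+ 2 * rnorm x ^+ k * (rnorm (a1 - b) * rnorm (a2 - b))
    * (rnorm c * lnorm M f ^+ k * (M + rnorm b)) ^+ 2 =
  rnorm c ^+ 4 * (rnorm (a1 - b) * rnorm (a2 - b) * (M + rnorm b) ^+ 2) * y ^+ k.
  have -> : y ^+ k = rnorm x ^+ k * (lnorm M f ^+ k) ^+ 2.
    by rewrite /y exprMn -!exprM mulnC.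
  by ring.
have h4 : rnorm (a1 - b) * rnorm (a2 - b) * (M + rnorm b) ^+ 2
    <= (n.+1%:R + rnorm b) ^+ 4.
  have -> : (n.+1%:R + rnorm b) ^+ 4 = (n.+1%:R + rnorm b) ^+ 2 * (n.+1%:R + rnorm b) ^+ 2.
    by rewrite -exprD.
  by apply: ler_pM => //; rewrite ?mulr_ge0 ?exprn_ge0 ?addr_ge0 ?rnorm_ge0.
have p2 m : 0 < (2 : R) ^+ m by rewrite exprn_gt0.
have := hk; rewrite -ler_pdivlMr // => hk'.
apply: le_trans (_ : 2 ^+ k / 2 ^+ n.+2 * 2^-1 ^+ k <= _); last first.
  by rewrite !exprVn mulrAC divff ?mul1r // gt_eqF.
apply: ler_pM => //.
- by rewrite !mulr_ge0 ?exprn_ge0 ?addr_ge0 ?rnorm_ge0.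
- by rewrite exprn_ge0.
by apply: le_trans hk'; rewrite ler_wpM2l // exprn_ge0 // rnorm_ge0.
Qed.

(** One of the two values at a1, a2 contains the small factor a1 - b or a2 - b; everything else is
    at most K on the disc of radius n + 1, so one e serves all M up to n + 1. *)
Lemma lsmall_start n c k b f : exists2 e : R, 0 < e & forall M a1 a2,
  0 <= M -> M <= n.+1%:R -> rnorm a1 <= M -> rnorm a2 <= M ->
  rnorm (a1 - b) < e \/ rnorm (a2 - b) < e ->
  lsmall M n.+1 (lstep c k b f) a1 a2.
Proof.
pose g := lstep c k b f; pose N : R := n.+1%:R.
pose K := rnorm c * lnorm N f ^+ k * lnorm N g ^+ 3.
have N0 : 0 <= N by rewrite /N.
have K0 : 0 <= K by rewrite /K !mulr_ge0 ?exprn_ge0 ?lnorm_ge0 ?rnorm_ge0.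
have p : 0 < (2^-1 : R) ^+ n.+2 by rewrite exprn_gt0 // invr_gt0.
exists (2^-1 ^+ n.+2 / (K + 1)); first by rewrite divr_gt0 // ltr_wpDl.
move=> M a1 a2 M0 MN h1 h2 h.
have main x y : rnorm x <= M -> rnorm y <= M -> rnorm (x - b) < 2^-1 ^+ n.+2 / (K + 1) ->
    rnorm (lev g x) * rnorm (lev g y) * lnorm M g ^+ 2 <= 2^-1 ^+ n.+2.
  move=> hx hy; rewrite ltr_pdivlMr; last by rewrite ltr_wpDl.
  move=> hxb; apply: le_trans (ltW hxb); rewrite {1}/g lev_step (rnormM _ (x - b)) (rnormM c) rnormX.
  have -> : rnorm c * rnorm (lev f x) ^+ k * rnorm (x - b) * rnorm (lev g y) * lnorm M g ^+ 2
    = rnorm (x - b) * (rnorm c * rnorm (lev f x) ^+ k * (rnorm (lev g y) * lnorm M g ^+ 2)).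
    by ring.
  apply: ler_wpM2l; first exact: rnorm_ge0.
  apply: le_trans (_ : K <= _); last by rewrite lerDl.
  have hg : lnorm M g <= lnorm N g by apply: lnorm_le.
  rewrite /K; apply: ler_pM; rewrite ?mulr_ge0 ?exprn_ge0 ?rnorm_ge0 ?lnorm_ge0 //.
    apply: ler_wpM2l; first exact: rnorm_ge0.
    apply: lerXn2r; rewrite ?nnegrE ?rnorm_ge0 ?lnorm_ge0 //.
    by apply: lev_le; apply: le_trans MN.
  rewrite [lnorm N g ^+ 3]exprS; apply: ler_pM; rewrite ?exprn_ge0 ?rnorm_ge0 ?lnorm_ge0 //.
    by apply: lev_le; apply: le_trans MN.
  by apply: lerXn2r; rewrite ?nnegrE ?lnorm_ge0.
rewrite /lsmall (rnormM (lev _ a1)) -/g; case: h => h; first exact: main.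
by rewrite [X in X * _]mulrC; apply: main.
Qed.

Lemma lsmall_le M M' n f a1 a2 : 0 <= M -> M <= M' ->
  lsmall M' n f a1 a2 -> lsmall M n f a1 a2.
Proof.
move=> M0 MM; apply: le_trans; apply: ler_wpM2l; first exact: rnorm_ge0.
have M'0 := le_trans M0 MM.
by apply: lerXn2r; rewrite ?nnegrE ?lnorm_ge0 ?lnorm_le.
Qed.

End LinearFactors.

(** * Recursive choice of the roots, constants and exponents *)

Section Sequences.
Context (R : realType) (Gamma : set R[i]) (q : nat -> R[i]).
Hypothesis Gamma_closed : forall b, ~ Gamma b ->
  exists2 d : R, 0 < d & forall t, Gamma t -> d <= rnorm (t - b).
Hypothesis Gamma_codense : forall b (e : R), 0 < e ->
  exists2 b', rnorm (b' - b) < e & ~ Gamma b'.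
Hypothesis Gamma_bounded : forall t, Gamma t -> rnorm t <= 2.

(* A state is a polynomial together with a bound, exceeded by the modulus of
   the polynomial on Gamma, on the partial sums of the series so far. *)
Let state := (lfac R * R)%type.

Let inv (s : state) : Prop :=
  1 <= s.2 /\ forall t, Gamma t -> s.2 < rnorm (lev s.1 t).

(** The triple holds the new root b, the constant c, and k where the exponent is k + 1. If q n lies
    on Gamma, the old polynomial must also be large at b, since the series will be evaluated with
    one coordinate equal to b. *)
Let next (n : nat) (s : state) (s' : state) (bck : R[i] * R[i] * nat) : Prop :=
  let: (b, c, k) := bck in
  [/\ inv s', ~ Gamma b, rnorm (b - q n) < n.+1%:R^-1,
      Gamma (q n) -> s.2 < rnorm (lev s.1 b)
    & [/\ s'.1 = lstep c k.+1 b s.1, s'.2 = s.2 + 1 + lnorm 3 s.1 ^+ 4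
        & rnorm c ^+ 4 * (n.+1%:R + rnorm b) ^+ 4 * 2 ^+ n.+2 <= 2 ^+ k.+1]].

(** First b is taken off Gamma, close to q n. It has a distance d > 0 from Gamma, and |theta_n| is
    at least 1 on Gamma, so c of order 1 / d makes the new polynomial large there whatever the
    exponent; the exponent is therefore free to be chosen last, in terms of b and c. *)
Lemma exists_next n s : inv s -> exists s' bck, next n s s' bck.
Proof.
move=> [s1 sG].
have [e e0 He] : exists2 e : R, 0 < e & forall b, rnorm (b - q n) < e ->
    rnorm (b - q n) < n.+1%:R^-1 /\ (Gamma (q n) -> s.2 < rnorm (lev s.1 b)).
  have n0 : 0 < (n.+1%:R^-1 : R) by rewrite invr_gt0.
  have [Gq|nGq] := pselect (Gamma (q n)); last by exists n.+1%:R^-1 => // b ->; split.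
  have gap := sG _ Gq.
  have [d _ Hd] := @lev_taylor R (rnorm (q n) + 1) s.1 (q n) ltac:(by rewrite addrK).
  set L := lnorm _ _ in Hd.
  have L0 : 0 <= L by apply: lnorm_ge0; rewrite addr_ge0 ?rnorm_ge0.
  pose gp := rnorm (lev s.1 (q n)) - s.2.
  have gp0 : 0 < gp by rewrite subr_gt0.
  (* The three bounds give the rate of approximation, the range of [lev_taylor], and an increment
     smaller than the gap gp. *)
  exists (Order.min n.+1%:R^-1 (Order.min 1 (gp / (L + 1)))).
    by rewrite !lt_min n0 ltr01 divr_gt0 // ltr_wpDl.
  move=> b; rewrite !lt_min => /and3P[h1 h2].
  rewrite ltr_pdivlMr => [h3|]; last by rewrite ltr_wpDl.
  split=> // _; have [_ + _] := Hd _ (ltW h2); rewrite subrKC => h4.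
  have := rnormB (lev s.1 b) (lev s.1 b - lev s.1 (q n)).
  rewrite opprB addrC subrK => h5.
  have hb := rnorm_ge0 (b - q n).
  have h6 : L * rnorm (b - q n) <= rnorm (b - q n) * (L + 1).
    by rewrite mulrC ler_wpM2l // lerDl.
  by rewrite /gp in h3; lra.
have [b bq bG] := Gamma_codense (q n) e0.
have [bn bs] := He b bq.
have [d d0 dG] := Gamma_closed bG.
(* The last summand bounds the next term of the series, a product of four values on the disc of
   radius 3: Gamma has radius 2, and a root chosen near a point of Gamma is within 1 of it. *)
pose r' := s.2 + 1 + lnorm 3 s.1 ^+ 4.
have r1 : 1 <= r'.
  have : 0 <= lnorm 3 s.1 ^+ 4 by rewrite exprn_ge0 // lnorm_ge0.
  by rewrite /r'; lra.
pose c : R[i] := (((r' + 1) / d)%:C)%C.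
have cE : rnorm c = (r' + 1) / d.
  by rewrite rnormR ger0_norm // divr_ge0 // ?(ltW d0) //; lra.
have [k hk] := exists_pow2_ge (rnorm c ^+ 4 * (n.+1%:R + rnorm b) ^+ 4 * 2 ^+ n.+2).
exists (lstep c k.+1 b s.1, r'), (b, c, k); split => //; last first.
  by split=> //; apply: le_trans hk _; rewrite ler_weXn2l // ler1n.
split=> //= t Gt.
rewrite lev_step (rnormM _ (t - b)) (rnormM c) rnormX cE.
have h1 : 1 <= rnorm (lev s.1 t) ^+ k.+1.
  by apply: exprn_ege1; apply: le_trans s1 (ltW (sG _ Gt)).
have h2 := dG _ Gt.
apply: lt_le_trans (_ : (r' + 1) / d * 1 * d <= _).
  by rewrite mulr1 divfK ?gt_eqF //; lra.
have cp : 0 <= (r' + 1) / d by rewrite -cE rnorm_ge0.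
by apply: ler_pM; rewrite ?mulr1 ?(ltW d0) // -[X in X <= _]mulr1 ler_wpM2l.
Qed.

(** Iterates [exists_next]. In the lower bound, the term of index n is at least r n in modulus while
    the earlier ones sum to at most r n - n - 1. For the smallness, [lsmall_start] applies at a root
    of large index close to a1 or a2, and [lsmall_step] carries the estimate to all later
    indices. *)
Lemma exists_sequences : exists (th : nat -> lfac R) (be : nat -> R[i]) (et : nat -> R),
  [/\ forall n, ~ Gamma (be n) /\ rnorm (be n - q n) < n.+1%:R^-1,
      forall n m, (n < m)%N -> lev (th m) (be n) = 0,
      forall n t1 t2 t3, Gamma (q n) -> Gamma t1 -> Gamma t2 -> Gamma t3 ->
        n%:R <= rnorm (\sum_(i < n.+1) lev (th i) t1 * lev (th i) t2 *
                         (lev (th i) (be n) * lev (th i) t3)),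
      forall n, 0 < et n
    & forall a1 a2, (forall e : R, 0 < e -> exists j,
        rnorm (a1 - be j) < e * et j \/ rnorm (a2 - be j) < e * et j) ->
      forall M : R, 0 <= M -> exists n0, forall n, (n0 <= n)%N -> lsmall M n (th n) a1 a2].
Proof.
have inv0 : inv (((2%:R : R[i]), [::]), 1).
  split=> //= t _; rewrite lev.unlock big_nil mulr1.
  by have := @rnormR R 2; rewrite rmorph_nat => ->; rewrite ger0_norm //; lra.
have /choice[F HF] : forall x : nat * {s | inv s}, exists y : {s | inv s} * (R[i] * R[i] * nat),
    next x.1 (sval x.2) (sval y.1) y.2.
  move=> [n [s si]]; have [s' [bck H]] := exists_next n si.
  have si' : inv s' by case: bck H => [[b c] k] [].
  by exists (exist _ s' si', bck).
pose S := fix S n := if n is n'.+1 then (F (n', S n')).1 else exist _ _ inv0.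
pose D n := (F (n, S n)).2.
have HS n : next n (sval (S n)) (sval (S n.+1)) (D n) by exact: (HF (n, S n)).
pose th n := (sval (S n)).1; pose r n := (sval (S n)).2.
pose be n := (D n).1.1; pose c n := (D n).1.2; pose k n := (D n).2.
have HS' n : [/\ ~ Gamma (be n), rnorm (be n - q n) < n.+1%:R^-1,
   Gamma (q n) -> r n < rnorm (lev (th n) (be n))
  & [/\ th n.+1 = lstep (c n) (k n).+1 (be n) (th n), r n.+1 = r n + 1 + lnorm 3 (th n) ^+ 4
     & rnorm (c n) ^+ 4 * (n.+1%:R + rnorm (be n)) ^+ 4 * 2 ^+ n.+2 <= 2 ^+ (k n).+1]].
  by have := HS n; rewrite /be /c /k /th /r; case: (D n) => [[b' c'] k'] [].
have invS n : inv (th n, r n) by rewrite -surjective_pairing; case: (S n).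
clearbody th r be c k; clear S D HS F HF.
have thS n : th n.+1 = lstep (c n) (k n).+1 (be n) (th n) by have [_ _ _ []] := HS' n.
have rS n : r n.+1 = r n + 1 + lnorm 3 (th n) ^+ 4 by have [_ _ _ []] := HS' n.
have /choice[et Het] : forall n, exists e : R, 0 < e /\ forall M a1 a2,
    0 <= M -> M <= n.+1%:R -> rnorm a1 <= M -> rnorm a2 <= M ->
    rnorm (a1 - be n) < e \/ rnorm (a2 - be n) < e -> lsmall M n.+1 (th n.+1) a1 a2.
  move=> n; have [e e0 He] := lsmall_start n (c n) (k n).+1 (be n) (th n).
  by exists e; split => //; rewrite thS.
have L3 n : 0 <= lnorm 3 (th n) by apply: lnorm_ge0.
have zero n m : (n < m)%N -> lev (th m) (be n) = 0.
  elim: m => // m IH; rewrite ltnS thS lev_step leq_eqVlt => /predU1P[->|nm].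
    by rewrite subrr mulr0.
  by rewrite IH // expr0n /= mulr0 mul0r.
exists th, be, et; split=> //.
- by move=> n; have [? ? _ _] := HS' n.
- move=> n t1 t2 t3 Gq G1 G2 G3.
  have [_ bq /(_ Gq) lb _] := HS' n.
  have [r1 rG] := invS n; rewrite /= in r1 rG.
  have b3 : rnorm (be n) <= 3.
    rewrite -(subrK (q n) (be n)); apply: le_trans (rnormD _ _) _.
    have h1 := Gamma_bounded Gq.
    have h2 : n.+1%:R^-1 <= 1 :> R by rewrite invf_le1 // ler1n.
    have -> : (3 : R) = 1 + 2 by ring.
    by apply: lerD => //; apply: ltW; apply: lt_le_trans bq h2.
  have G3' t : Gamma t -> rnorm t <= 3.
    by move=> /Gamma_bounded h; apply: le_trans h _; lra.
  pose T i := lev (th i) t1 * lev (th i) t2 * (lev (th i) (be n) * lev (th i) t3).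
  have Tle i : rnorm (T i) <= lnorm 3 (th i) ^+ 4.
    rewrite /T (rnormM (_ * _)) (rnormM (lev _ t1)) (rnormM (lev _ (be n))).
    rewrite (exprD _ 2 2) expr2.
    have e1 := lev_le (th i) (G3' _ G1); have e2 := lev_le (th i) (G3' _ G2).
    have e3 := lev_le (th i) (G3' _ G3); have e4 := lev_le (th i) b3.
    by do 2?[apply: ler_pM => //]; rewrite ?mulr_ge0 ?rnorm_ge0.
  have rsum m : m%:R + 1 + rnorm (\sum_(i < m) T i) <= r m.
    elim: m => [|m IH]; first by rewrite big_ord0 rnorm0 add0r addr0; case: (invS 0%N).
    rewrite big_ord_recr rS -natr1 /=.
    have := rnormD (\sum_(i < m) T i) (T m); have := Tle m.
    by move: IH; lra.
  have Tn : r n <= rnorm (T n).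
    rewrite /T (rnormM (_ * _)) (rnormM (lev _ t1)) (rnormM (lev _ (be n))).
    have ge1 t : r n < rnorm (lev (th n) t) -> 1 <= rnorm (lev (th n) t).
      by move=> /ltW; apply: le_trans.
    have r0 : 0 <= r n by apply: le_trans r1.
    have -> : r n = r n * 1 * (1 * 1) by rewrite !mulr1.
    have g1 := ge1 _ (rG _ G2); have g2 := ge1 _ (rG _ G3); have g3 := ge1 _ (lb).
    have g4 := ltW (rG _ G1).
    by do 2?[apply: ler_pM => //]; rewrite ?mulr1.
  rewrite big_ord_recr /= -/(T n).
  set A := \sum_(i < n) _; have := rsum n; rewrite -/A => hA.
  have := rnormB (A + T n) A; rewrite [A + _]addrC addrK => h.
  lra.
- by move=> n; have [] := Het n.
move=> a1 a2 Ha M M0.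
(* If a1 or a2 is a root, all later polynomials vanish there and the estimate is trivial. *)
have [[j aj]|naj] := pselect (exists j, a1 = be j \/ a2 = be j).
  exists j.+1 => n jn; rewrite /lsmall.
  have -> : lev (th n) a1 * lev (th n) a2 = 0.
    by case: aj => ->; rewrite zero // ?mul0r ?mulr0.
  by rewrite rnorm0 mul0r exprn_ge0 // invr_ge0.
pose N := Num.bound (M + rnorm a1 + rnorm a2).
have hN : M + rnorm a1 + rnorm a2 <= N%:R.
  by apply/ltW/archi_boundP; rewrite !addr_ge0 ?rnorm_ge0.
(* As neither point is a root, the first N roots are at least e away relative to et. A better
   approximation comes from a root of index at least N, where the radius N is admissible in
   [Het]. *)
have [e e0 He] : exists2 e : R, 0 < e & forall j, (j < N)%N ->
    e * et j <= rnorm (a1 - be j) /\ e * et j <= rnorm (a2 - be j).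
  elim: (N) => [|m [e e0 IH]]; first by exists 1.
  have [em _] := Het m.
  have d0 : 0 < Order.min (rnorm (a1 - be m)) (rnorm (a2 - be m)).
    rewrite lt_min; apply/andP; split; apply: rnorm_gt0; rewrite subr_eq0; apply/eqP => E;
      by apply: naj; exists m; auto.
  exists (Order.min e (Order.min (rnorm (a1 - be m)) (rnorm (a2 - be m)) / et m)).
    by rewrite lt_min e0 divr_gt0.
  move=> j; rewrite ltnS leq_eqVlt => /predU1P[->|jm].
    have : Order.min e (Order.min (rnorm (a1 - be m)) (rnorm (a2 - be m)) / et m) * et m
        <= Order.min (rnorm (a1 - be m)) (rnorm (a2 - be m)).
      by rewrite -ler_pdivlMr // ge_min lexx orbT.
    by rewrite le_min => /andP[].
  have [h1 h2] := IH j jm; have [ej _] := Het j.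
  have h3 : Order.min e (Order.min (rnorm (a1 - be m)) (rnorm (a2 - be m)) / et m) * et j
      <= e * et j by rewrite ler_wpM2r ?(ltW ej) // ge_min lexx.
  by split; apply: le_trans h3 _.
(* The bound e forces the index up; the bound 1 puts the point within et j of the root. *)
have [|j Hj] := Ha (Order.min e 1); first by rewrite lt_min e0 ltr01.
have [ej Hs] := Het j.
have jN : (N <= j)%N.
  rewrite leqNgt; apply/negP => /He[h1 h2].
  have h3 : Order.min e 1 * et j <= e * et j by rewrite ler_wpM2r ?(ltW ej) // ge_min lexx.
  by case: Hj; lra.
have [? ?] : 0 <= rnorm a1 /\ 0 <= rnorm a2 by rewrite !rnorm_ge0.
have NR n : (j <= n)%N -> N%:R <= n.+1%:R :> R.
  by move=> jn; rewrite ler_nat (leq_trans jN) // ltnW.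
have h1 : rnorm a1 <= N%:R by lra.
have h2 : rnorm a2 <= N%:R by lra.
exists j.+1 => n jn; apply: (@lsmall_le _ _ N%:R) => //; first by lra.
elim: n jn => // n IH; rewrite ltnS leq_eqVlt => /predU1P[jn|jn].
  rewrite -jn; apply: Hs => //; first exact: NR.
  have h3 : Order.min e 1 * et j <= et j.
    by rewrite -[X in _ <= X]mul1r ler_wpM2r ?(ltW ej) // ge_min lexx orbT.
  by case: Hj => h; [left|right]; lra.
rewrite thS; apply: lsmall_step => //.
- by apply: NR; apply: ltnW.
- by have [_ _ _ []] := HS' n.
exact: IH.
Qed.

End Sequences.

(** * Concentric squares and an enumeration of the rational points *)

Section Squares.
Context (R : realType).
Local Open Scope complex_scope.
Implicit Types (t b : R[i]).

Definition snorm t : R := Order.max `|complex.Re t| `|complex.Im t|.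

Lemma snorm_le_rnorm t : snorm t <= rnorm t.
Proof. by rewrite /snorm ge_max Re_rnorm Im_rnorm. Qed.

Lemma rnorm_le_snorm t : rnorm t <= 2 * snorm t.
Proof.
apply: le_trans (rnorm_ReIm t) _; rewrite /snorm mulr_natl mulr2n.
by apply: lerD; rewrite le_max lexx ?orbT.
Qed.

Lemma snorm_ge0 t : 0 <= snorm t.
Proof. by rewrite /snorm le_max normr_ge0. Qed.

Lemma snormD t b : snorm (t + b) <= snorm t + snorm b.
Proof.
case: t b => [x y] [x' y']; rewrite /snorm /= ge_max; apply/andP; split;
  apply: le_trans (ler_normD _ _) _; apply: lerD; rewrite le_max lexx ?orbT //.
Qed.

Lemma snorm_dist t b : `|snorm t - snorm b| <= rnorm (t - b).
Proof.
apply: le_trans (snorm_le_rnorm _); rewrite ler_norml lerBlDr lerNl opprB lerBlDr.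
have := snormD (t - b) b; rewrite subrK => ->; rewrite andbT.
have := snormD (b - t) t; rewrite subrK.
suff -> : snorm (b - t) = snorm (t - b) by [].
by case: t b => [x y] [x' y']; rewrite /snorm /= -normrN opprB -[`|y' - y|]normrN opprB.
Qed.

Lemma snorm_scale (c : R) t : 0 <= c -> snorm (c%:C * t) = c * snorm t.
Proof.
case: t => x y c0; rewrite /snorm /= !mul0r subr0 addr0 !normrM ger0_norm //.
by rewrite maxr_pMr.
Qed.

(* The boundaries of the squares of half-sides 2^-m, together with their
   centre, described as the complement of an open set. *)
Definition squares t : Prop :=
  snorm t <= 1 /\ forall m, ~ (2^-1 ^+ m.+1 < snorm t < 2^-1 ^+ m).

Lemma squares_pow m t : snorm t = 2^-1 ^+ m -> squares t.
Proof.
move=> tm; split=> [|k]; rewrite tm.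
  by apply: exprn_ile1; rewrite ?invr_ge0 // invf_le1 // ler1n.
have h : {homo (fun n => (2^-1 : R) ^+ n) : i j / (i <= j)%N >-> j <= i}.
  by move=> i j ij; apply: ler_wiXn2l; rewrite ?invr_ge0 // invf_le1 // ler1n.
move=> /andP[h1 h2]; have [km|mk] := leqP k m.
  have [km'|mk'] := leqP k.+1 m; first by have := h _ _ km'; rewrite leNgt h1.
  by move: h2; rewrite (_ : m = k) ?ltxx //; apply/eqP; rewrite eqn_leq -ltnS mk' km.
by have := h _ _ (ltnW mk); rewrite leNgt h2.
Qed.

Lemma squares_bounded t : squares t -> rnorm t <= 2.
Proof.
move=> [t1 _]; apply: le_trans (rnorm_le_snorm t) _.
by rewrite -[X in _ <= X]mulr1 ler_wpM2l.
Qed.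

(** A point off [squares] lies outside the unit square or strictly between two consecutive squares.
    Since [snorm] is 1-Lipschitz, its distance in [snorm] to the ends of that gap can serve as d. *)
Lemma squares_closed b : ~ squares b ->
  exists2 d : R, 0 < d & forall t, squares t -> d <= rnorm (t - b).
Proof.
move=> nb; have [b1|b1] := leP (snorm b) 1; last first.
  exists (snorm b - 1); rewrite ?subr_gt0 // => t [t1 _].
  by have := snorm_dist t b; rewrite ler_norml => /andP[h _]; lra.
have [m /andP[m1 m2]] : exists m, 2^-1 ^+ m.+1 < snorm b < 2^-1 ^+ m.
  by apply: contrapT => H; apply: nb; split=> // m h; apply: H; exists m.
exists (Order.min (snorm b - 2^-1 ^+ m.+1) (2^-1 ^+ m - snorm b)).
  by rewrite lt_min !subr_gt0 m1.
move=> t [_ /(_ m) tm]; rewrite leNgt; apply/negP; rewrite lt_min => /andP[h1 h2].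
apply: tm; have := snorm_dist t b; rewrite ler_norml => /andP[? ?].
by apply/andP; split; lra.
Qed.

(** Near the centre, real points midway between two squares will do; a point on the boundary of a
    square is shrunk slightly into the gap inside it. *)
Lemma squares_codense b (e : R) : 0 < e ->
  exists2 b', rnorm (b' - b) < e & ~ squares b'.
Proof.
move=> e0; have [[b1 Hb]|] := pselect (squares b); last first.
  by exists b => //; rewrite subrr rnorm0.
have [s0|s0] := eqVneq (snorm b) 0.
  have [m me] := exists_half_lt 1 e0.
  have p : (0 : R) < 2 ^+ m by rewrite exprn_gt0.
  have b0 : b = 0.
    by apply: rnorm_eq0; apply/le_anti; rewrite rnorm_ge0 andbT;
       have := rnorm_le_snorm b; rewrite s0 mulr0.
  pose x : R := 3 / 4 / 2 ^+ m.
  have x0 : 0 <= x by rewrite /x !divr_ge0 // ltW.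
  exists x%:C; rewrite ?b0 ?subr0 ?rnormR ?ger0_norm //.
    by apply: le_lt_trans me; rewrite /x ler_pM2r ?invr_gt0 //; lra.
  have sx : snorm x%:C = x by rewrite /snorm /= normr0 ger0_norm // max_l.
  move=> [_ /(_ m)]; apply; rewrite sx /x exprS exprVn.
  by rewrite ltr_pM2r ?invr_gt0 // gtr_pMl ?invr_gt0 //; apply/andP; split; lra.
have {}s0 : 0 < snorm b by rewrite lt_neqAle eq_sym s0 snorm_ge0.
have exm : exists m, 2^-1 ^+ m.+1 < snorm b.
  have [m hm] := exists_half_lt 1 s0; exists m.
  by apply: le_lt_trans hm; rewrite mul1r -exprVn exprS ler_piMl ?exprn_ge0 ?invr_ge0 // invf_le1 // ler1n.
(* Minimality gives snorm b at most 2^-m, the case m = 0 being the bound by 1; the gap condition in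
   [squares] then gives equality. *)
have [m hm mmin] := ex_minnP exm.
have sm : snorm b = 2^-1 ^+ m.
  apply/le_anti/andP; split.
    case: m hm mmin => [//|m] hm mmin; rewrite leNgt; apply/negP => h.
    by have := mmin m h; rewrite ltnn.
  by rewrite leNgt; apply/negP => h; apply: (Hb m); rewrite hm.
(* With 1/4, the factor 1 - dl stays above 1/2, so the point does not reach the next square; with e
   / 4, it moves by at most e / 2, as |b| is at most 2. *)
pose dl := Order.min (1 / 4) (e / 4).
have dl0 : 0 < dl by rewrite lt_min !divr_gt0.
have [d1 d2] : dl <= 1 / 4 /\ dl <= e / 4 by rewrite /dl !ge_min !lexx orbT.
exists ((1 - dl)%:C * b).
  have -> : (1 - dl)%:C * b - b = - (dl%:C * b) by rewrite rmorphB /=; ring.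
  rewrite rnormN rnormM rnormR gtr0_norm //.
  apply: le_lt_trans (_ : dl * (2 * 1) < _); last by lra.
  apply: ler_wpM2l; first exact: ltW.
  by apply: le_trans (rnorm_le_snorm b) _; rewrite ler_wpM2l.
move=> [_ /(_ m)]; apply; rewrite snorm_scale; last by lra.
have p : (0 : R) < 2^-1 ^+ m by rewrite exprn_gt0 // invr_gt0.
rewrite sm exprS ltr_pM2r // gtr_pMl //; apply/andP; split; lra.
Qed.

(** Only the 2-adic valuation of n is decoded, so every rational point occurs at infinitely many
    indices. This matters because the n-th root is only within 1 / (n + 1) of the n-th point. *)
Definition rat_point (n : nat) : R[i] :=
  if unpickle (logn 2 n) is Some xy then
    ratr (xy : rat * rat).1 +i* ratr (xy : rat * rat).2 else 0.

Lemma rat_point_onto (x y : rat) N :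
  exists2 n, (N <= n)%N & rat_point n = ratr x +i* ratr y.
Proof.
pose k := pickle (x, y); exists (2 ^ k * (2 * N).+1)%N.
  by rewrite (leq_trans _ (leq_pmull _ _)) ?expn_gt0 //; lia.
rewrite /rat_point lognM ?expn_gt0 // pfactorK // (@logn_coprime 2 (2 * N).+1).
  by rewrite addn0 /k pickleK.
by rewrite coprime2n /= oddM.
Qed.

Lemma rat_near (a b x e : R) : a <= x <= b -> a < b -> 0 < e ->
  exists y : rat, a < ratr y < b /\ `|ratr y - x| < e.
Proof.
move=> /andP[ax xb] ab e0.
have [|y] := @rat_in_itvoo R (Order.max a (x - e)) (Order.min b (x + e)).
  by rewrite lt_min !gt_max ab /=; apply/and3P; split; lra.
rewrite in_itv /= gt_max lt_min => /andP[/andP[h1 h2] /andP[h3 h4]].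
by exists y; rewrite h1 h3; split => //; rewrite ltr_norml; apply/andP; split; lra.
Qed.

Lemma rat_point_dense t (e : R) N : 0 < e ->
  exists2 n, (N <= n)%N & rnorm (rat_point n - t) < e.
Proof.
move=> e0; have e2 : 0 < e / 2 by rewrite divr_gt0.
have near (z : R) : exists y : rat, `|ratr y - z| < e / 2.
  have z1 : z - 1 <= z <= z + 1 by apply/andP; split; lra.
  have z2 : z - 1 < z + 1 by lra.
  by have [y [_ hy]] := rat_near z1 z2 e2; exists y.
have [x hx] := near (complex.Re t); have [y hy] := near (complex.Im t).
have [n nN nE] := rat_point_onto x y N; exists n => //; rewrite nE.
apply: le_lt_trans (rnorm_ReIm _) _; case: t hx hy => a b /= hx hy; lra.
Qed.

(** On the boundary of the square one coordinate is 2^-m up to sign, which is rational; the other is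
    approximated by a rational without leaving the side. *)
Lemma rat_point_dense_square t m (e : R) N : snorm t = 2^-1 ^+ m -> 0 < e ->
  exists n, [/\ (N <= n)%N, rnorm (rat_point n - t) < e & squares (rat_point n)].
Proof.
move=> tm e0; pose c : rat := 2^-1 ^+ m; pose r : R := 2^-1 ^+ m.
have cE : ratr c = r by rewrite /c /r rmorphXn /= fmorphV rmorph_nat.
have r0 : 0 < r by rewrite exprn_gt0 // invr_gt0.
have main (x y : rat) : snorm (ratr x +i* ratr y : R[i]) = r ->
    `|ratr x - complex.Re t| + `|ratr y - complex.Im t| < e ->
    exists n, [/\ (N <= n)%N, rnorm (rat_point n - t) < e & squares (rat_point n)].
  move=> h1 h2; have [n nN nE] := rat_point_onto x y N; exists n; rewrite nE; split => //.
    by apply: le_lt_trans (rnorm_ReIm _) _; case: t {tm} h2 => a b.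
  exact: squares_pow h1.
have near (z : R) : `|z| <= r -> exists y : rat, `|ratr y : R| <= r /\ `|ratr y - z| < e.
  rewrite ler_norml => zr; have rr : - r < r by lra.
  have [y [hy1 hy2]] := rat_near zr rr e0.
  by exists y; split => //; rewrite ler_norml; case/andP: hy1 => ? ?; rewrite !ltW.
have sg (z : R) : `|z| = r -> exists y : rat, ratr y = z.
  move=> zr; have [z0|z0] := leP 0 z.
    by exists c; rewrite cE -zr ger0_norm.
  by exists (- c); rewrite rmorphN /= cE -zr ltr0_norm // opprK.
case: t tm main => a b /=; rewrite /snorm /= -/r => tm main.
have ar : `|a| <= r by rewrite -tm le_max lexx.
have br : `|b| <= r by rewrite -tm le_max lexx orbT.
have [hab|hab] := leP `|a| `|b|.
  have eb : `|b| = r by exact: etrans (esym (max_r hab)) tm.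
  have [y hy] := sg b eb; have [x [hx1 hx2]] := near a ar.
  by apply: (main x y); rewrite hy ?subrr ?normr0 ?addr0 // eb max_r.
have ea : `|a| = r by exact: etrans (esym (max_l (ltW hab))) tm.
have [x hx] := sg a ea; have [y [hy1 hy2]] := near b br.
by apply: (main x y); rewrite hx ?subrr ?normr0 ?add0r // ea max_l.
Qed.

Lemma exists_poles : exists (th : nat -> lfac R) (be : nat -> R[i]) (et : nat -> R),
  [/\ forall n, ~ squares (be n),
      forall t (e : R), 0 < e -> exists n, rnorm (be n - t) < e,
      forall n m, (n < m)%N -> lev (th m) (be n) = 0,
      forall t m (e : R) (K : nat), snorm t = 2^-1 ^+ m -> 0 < e ->
        exists2 n, rnorm (be n - t) < e &
        forall t1 t2 t3, squares t1 -> squares t2 -> squares t3 ->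
        K%:R <= rnorm (\sum_(i < n.+1) lev (th i) t1 * lev (th i) t2 *
                         (lev (th i) (be n) * lev (th i) t3))
    & (forall n, 0 < et n) /\
      forall a1 a2, (forall e : R, 0 < e -> exists j,
        rnorm (a1 - be j) < e * et j \/ rnorm (a2 - be j) < e * et j) ->
      forall M : R, 0 <= M -> exists n0, forall n, (n0 <= n)%N -> lsmall M n (th n) a1 a2].
Proof.
have [th [be [et [h1 h2 h3 h4 h5]]]] :=
  @exists_sequences R squares rat_point squares_closed squares_codense squares_bounded.
have inv_small (e : R) : 0 < e -> exists N, forall n, (N <= n)%N -> n.+1%:R^-1 < e.
  move=> e0; exists (Num.bound e^-1) => n Nn.
  rewrite invf_plt ?posrE //; apply: lt_le_trans (archi_boundP _) _.
    by rewrite invr_ge0 ltW.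
  by rewrite ler_nat leqW.
exists th, be, et; split=> //.
- by move=> n; case: (h1 n).
- move=> t e e0; have [N HN] := inv_small (e / 2) (divr_gt0 e0 (ltr0n _ 2)).
  have [n nN hn] := @rat_point_dense t (e / 2) N (divr_gt0 e0 (ltr0n _ 2)).
  exists n; have [_ hb] := h1 n; have := HN n nN.
  have -> : be n - t = (be n - rat_point n) + (rat_point n - t) by rewrite addrA subrK.
  move=> hN; apply: le_lt_trans (rnormD _ _) _.
  by rewrite [e]splitr; apply: ltrD => //; apply: lt_trans hb hN.
- move=> t m e K tm e0; have [N HN] := inv_small (e / 2) (divr_gt0 e0 (ltr0n _ 2)).
  (* An index beyond N makes the root close to the rational point; beyond K it makes the lower bound
     n of [exists_sequences] at least K. *)
  have [n [nN hn sq]] := @rat_point_dense_square t m (e / 2) (maxn N K) tm (divr_gt0 e0 (ltr0n _ 2)).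
  have [_ hb] := h1 n; have := HN n (leq_trans (leq_maxl _ _) nN) => hN.
  exists n.
    have -> : be n - t = (be n - rat_point n) + (rat_point n - t) by rewrite addrA subrK.
    apply: le_lt_trans (rnormD _ _) _.
    by rewrite [e]splitr; apply: ltrD => //; apply: lt_trans hb hN.
  move=> t1 t2 t3 s1 s2 s3; apply: le_trans (h3 n t1 t2 t3 sq s1 s2 s3).
  by rewrite ler_nat (leq_trans _ nN) // leq_maxr.
Qed.

End Squares.

(** * Holomorphic series *)

Section ComplexLimits.
Context (R : realType).
Implicit Types (u v : nat -> R[i]) (l : R[i]).
Local Open Scope complex_scope.

Definition ccvg u l : Prop :=
  forall e : R, 0 < e -> exists N, forall n, (N <= n)%N -> rnorm (u n - l) < e.

(** The default 0 at divergent sequences makes the sum of the series a total function. *)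
Definition clim u : R[i] := xget 0 [set l | ccvg u l].

Lemma ccvg_le u l (B : R) : ccvg u l ->
  (exists N, forall n, (N <= n)%N -> rnorm (u n) <= B) -> rnorm l <= B.
Proof.
move=> ul [N HN]; apply/ler_addgt0Pr => e e0; have [N' HN'] := ul e e0.
have h1 := HN _ (leq_maxl N N'); have h2 := HN' _ (leq_maxr N N').
have := rnormB (u (maxn N N')) (u (maxn N N') - l).
rewrite opprB addrC subrK => h3; apply: le_trans h3 _; apply: lerD => //; exact: ltW.
Qed.

Lemma ccvgD u v l l' : ccvg u l -> ccvg v l' -> ccvg (fun n => u n + v n) (l + l').
Proof.
move=> ul vl e e0; have e2 : 0 < e / 2 by rewrite divr_gt0.
have [N HN] := ul _ e2; have [N' HN'] := vl _ e2.
exists (maxn N N') => n; rewrite geq_max => /andP[n1 n2].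
have -> : u n + v n - (l + l') = (u n - l) + (v n - l') by ring.
apply: le_lt_trans (rnormD _ _) _; rewrite [e]splitr.
by apply: ltrD; [exact: HN|exact: HN'].
Qed.

Lemma ccvgM (c : R[i]) u l : ccvg u l -> ccvg (fun n => c * u n) (c * l).
Proof.
move=> ul e e0; have c0 : 0 < rnorm c + 1 by rewrite ltr_wpDl ?rnorm_ge0.
have [N HN] := ul (e / (rnorm c + 1)) (divr_gt0 e0 c0); exists N => n /HN.
rewrite ltr_pdivlMr // => h; rewrite -mulrBr rnormM; apply: le_lt_trans h.
by rewrite mulrC ler_wpM2l ?rnorm_ge0 // lerDl.
Qed.

Lemma ccvgB u v l l' : ccvg u l -> ccvg v l' -> ccvg (fun n => u n - v n) (l - l').
Proof.
move=> ul vl; have := ccvgD ul (ccvgM (-1) vl); rewrite mulN1r.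
by congr ccvg; apply/funext => n; rewrite mulN1r.
Qed.

Lemma ccvg_unique u l l' : ccvg u l -> ccvg u l' -> l = l'.
Proof.
move=> ul ul'; apply/subr0_eq/rnorm_eq0/le_anti; rewrite rnorm_ge0 andbT.
by apply: ccvg_le (ccvgB ul ul') _; exists 0%N => n _; rewrite subrr rnorm0.
Qed.

Lemma climE u l : ccvg u l -> clim u = l.
Proof. by move=> ul; rewrite /clim; case: xgetP => [y _ /ccvg_unique|/(_ l)]; auto. Qed.

Lemma ccvg_const u l N : (forall n, (N <= n)%N -> u n = l) -> ccvg u l.
Proof. by move=> H e e0; exists N => n /H ->; rewrite subrr rnorm0. Qed.

(** For a real sequence f dominated by y, the sum of f is the difference of the sums of f + y and y,
    both nondecreasing and bounded. Real and imaginary parts are treated separately. *)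
Lemma ccvg_series (t : nat -> R[i]) (y : nat -> R) (Y : R) :
  (forall i, rnorm (t i) <= y i) -> (forall n, \sum_(i < n) y i <= Y) ->
  exists l, ccvg (fun n => \sum_(i < n) t i) l.
Proof.
move=> ty yY.
have real (f : nat -> R) : (forall i, `|f i| <= y i) ->
    exists r : R, forall e : R, 0 < e -> exists N, forall n, (N <= n)%N ->
      `|\sum_(i < n) f i - r| < e.
  have mono (g : nat -> R) (Z : R) : (forall i, 0 <= g i) ->
      (forall n, \sum_(i < n) g i <= Z) ->
      exists r : R, forall e : R, 0 < e -> exists N, forall n, (N <= n)%N ->
        `|\sum_(i < n) g i - r| < e.
    move=> g0 gZ; pose G n := \sum_(i < n) g i.
    have cG : cvgn G.
      apply: nondecreasing_is_cvgn; last by exists Z => _ [n _ <-]; exact: gZ.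
      by apply/nondecreasing_seqP => n; rewrite /G big_ord_recr lerDl.
    exists (limn G) => e e0; have /cvgrPdist_lt/(_ e e0)[N _ HN] := cG.
    by exists N => n Nn; rewrite distrC; exact: HN.
  move=> fy; have fyb i : - y i <= f i <= y i by rewrite -ler_norml.
  have y0 i : 0 <= y i := le_trans (normr_ge0 _) (fy i).
  have [|n|r1 H1] := mono (fun i => f i + y i) (Y + Y).
  - by move=> i; have /andP[? ?] := fyb i; lra.
  - rewrite big_split /=; apply: lerD; last exact: yY.
    by apply: le_trans (yY n); apply: ler_sum => i _; case/andP: (fyb i).
  have [r2 H2] := mono y Y y0 yY.
  exists (r1 - r2) => e e0; have e2 : 0 < e / 2 by rewrite divr_gt0.
  have [N HN] := H1 _ e2; have [N' HN'] := H2 _ e2.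
  exists (maxn N N') => n; rewrite geq_max => /andP[n1 n2].
  have := HN n n1; have := HN' n n2; rewrite big_split /= => h1 h2.
  have -> : \sum_(i < n) f i - (r1 - r2) =
    (\sum_(i < n) f i + \sum_(i < n) y i - r1) - (\sum_(i < n) y i - r2) by ring.
  by rewrite [e]splitr; apply: le_lt_trans (ler_normB _ _) _; apply: ltrD.
have [|a Ha] := real (fun i => complex.Re (t i)).
  by move=> i; apply: le_trans (Re_rnorm _) (ty i).
have [|b Hb] := real (fun i => complex.Im (t i)).
  by move=> i; apply: le_trans (Im_rnorm _) (ty i).
exists (a +i* b) => e e0; have e2 : 0 < e / 2 by rewrite divr_gt0.
have [N HN] := Ha _ e2; have [N' HN'] := Hb _ e2.
exists (maxn N N') => n; rewrite geq_max => /andP[n1 n2].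
apply: le_lt_trans (rnorm_ReIm _) _; rewrite [e]splitr.
have sumE : \sum_(i < n) t i = (\sum_(i < n) complex.Re (t i)) +i* (\sum_(i < n) complex.Im (t i)).
  elim: n {n1 n2} => [|n IH]; first by rewrite !big_ord0.
  by rewrite !big_ord_recr /= IH; case: (t n) => ? ?; simpc.
by rewrite sumE; simpc => /=; apply: ltrD; [exact: HN|exact: HN'].
Qed.

End ComplexLimits.

(** * Differentiability of the series in one group of variables *)

Section HolomorphicSeries.
Context (R : realType) (V : normedModType R[i]).
Context (l1 l2 : {linear V -> R[i]}) (y1 y2 : V -> R[i]) (K : R).
Hypothesis l1K : forall h, rnorm (l1 h) <= K * rnorm h.
Hypothesis l2K : forall h, rnorm (l2 h) <= K * rnorm h.
Hypothesis y1D : forall w h, y1 (w + h) = y1 w + l1 h.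
Hypothesis y2D : forall w h, y2 (w + h) = y2 w + l2 h.
Context (th : nat -> lfac R) (a1 a2 : R[i]).
Hypothesis small : forall M : R, 0 <= M ->
  exists n0, forall n, (n0 <= n)%N -> lsmall M n (th n) a1 a2.

Let x i := lev (th i) a1 * lev (th i) a2.
Let term w i := x i * (lev (th i) (y1 w) * lev (th i) (y2 w)).

(** Beyond n0 the terms are dominated by a geometric series of sum at most 1. *)
Lemma small_sum (M : R) : 0 <= M ->
  exists Y : R, forall n, \sum_(i < n) rnorm (x i) * lnorm M (th i) ^+ 2 <= Y.
Proof.
move=> M0; have [n0 H] := small M0.
have t0 i : 0 <= rnorm (x i) * lnorm M (th i) ^+ 2.
  by rewrite mulr_ge0 ?rnorm_ge0 // exprn_ge0 // lnorm_ge0.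
exists (\sum_(i < n0) rnorm (x i) * lnorm M (th i) ^+ 2 + 1) => n.
have geo m : \sum_(i < m) (2^-1 : R) ^+ i.+1 = 1 - 2^-1 ^+ m.
  elim: m => [|m IH]; first by rewrite big_ord0 expr0 subrr.
  by rewrite big_ord_recr /= IH exprS; field.
have [nn|nn] := leqP n n0.
  rewrite -(subnKC nn) big_split_ord /= -addrA lerDl addr_ge0 //.
  by apply: sumr_ge0 => i _; exact: t0.
rewrite -(subnKC (ltnW nn)) big_split_ord /= lerD2l.
apply: le_trans (_ : \sum_(i < n - n0) 2^-1 ^+ i.+1 <= _); last first.
  by rewrite geo gerBl exprn_ge0 // invr_ge0.
apply: ler_sum => i _ /=; apply: le_trans (H (n0 + i)%N (leq_addr _ _)) _.
by rewrite ler_wiXn2l ?invr_ge0 ?invf_le1 ?ler1n // ltnS leq_addl.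
Qed.

Lemma term_ccvg w : exists l, ccvg (fun n => \sum_(i < n) term w i) l.
Proof.
pose M := rnorm (y1 w) + rnorm (y2 w).
have M0 : 0 <= M by rewrite addr_ge0 ?rnorm_ge0.
have [Y HY] := small_sum M0; apply: (@ccvg_series R _ (fun i => rnorm (x i) * lnorm M (th i) ^+ 2) Y _ HY) => i /=.
rewrite /term rnormM; apply: ler_wpM2l; first exact: rnorm_ge0.
rewrite rnormM expr2; apply: ler_pM; rewrite ?rnorm_ge0 //; apply: lev_le.
  by rewrite lerDl rnorm_ge0.
by rewrite lerDr rnorm_ge0.
Qed.

(** Termwise Taylor expansion with a summable majorant. The remainder of a product splits into the
    remainder of either factor times the other factor, and the product of the two increments; this
    explains the 3. The 1 in M leaves the room that [lev_taylor] asks for. *)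
Lemma differentiable_series w :
  differentiable (fun w => clim (fun n => \sum_(i < n) term w i)) w.
Proof.
pose M := rnorm (y1 w) + rnorm (y2 w) + 1.
have n1 := rnorm_ge0 (y1 w); have n2 := rnorm_ge0 (y2 w).
have M0 : 0 <= M by rewrite /M; lra.
have [Y HY] := small_sum M0.
have Y0 : 0 <= Y by have := HY 0%N; rewrite big_ord0.
have /choice[d Hd] : forall i, exists d : R[i] * R[i],
    (rnorm d.1 <= lnorm M (th i) /\ forall h, rnorm h <= 1 ->
    [/\ rnorm (lev (th i) (y1 w + h)) <= lnorm M (th i),
        rnorm (lev (th i) (y1 w + h) - lev (th i) (y1 w)) <= lnorm M (th i) * rnorm h
      & rnorm (lev (th i) (y1 w + h) - lev (th i) (y1 w) - h * d.1) <= lnorm M (th i) * rnorm h ^+ 2])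
    /\ (rnorm d.2 <= lnorm M (th i) /\ forall h, rnorm h <= 1 ->
    [/\ rnorm (lev (th i) (y2 w + h)) <= lnorm M (th i),
        rnorm (lev (th i) (y2 w + h) - lev (th i) (y2 w)) <= lnorm M (th i) * rnorm h
      & rnorm (lev (th i) (y2 w + h) - lev (th i) (y2 w) - h * d.2) <= lnorm M (th i) * rnorm h ^+ 2]).
  move=> i.
  have [d1 h1 h2] := @lev_taylor R M (th i) (y1 w) ltac:(rewrite /M; lra).
  have [d2 h3 h4] := @lev_taylor R M (th i) (y2 w) ltac:(rewrite /M; lra).
  by exists (d1, d2).
pose A i := x i * ((d i).1 * lev (th i) (y2 w)).
pose B i := x i * (lev (th i) (y1 w) * (d i).2).
have L0 i : 0 <= lnorm M (th i) by apply: lnorm_ge0.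
have e1 i : rnorm (lev (th i) (y1 w)) <= lnorm M (th i) by apply: lev_le; rewrite /M; lra.
have e2 i : rnorm (lev (th i) (y2 w)) <= lnorm M (th i) by apply: lev_le; rewrite /M; lra.
have [|SA HA] := @ccvg_series R A (fun i => rnorm (x i) * lnorm M (th i) ^+ 2) Y _ HY.
  move=> i; have [[h1 _] _] := Hd i; rewrite /A rnormM ler_wpM2l ?rnorm_ge0 //.
  by rewrite rnormM expr2; apply: ler_pM; rewrite ?rnorm_ge0.
have [|SB HB] := @ccvg_series R B (fun i => rnorm (x i) * lnorm M (th i) ^+ 2) Y _ HY.
  move=> i; have [_ [h1 _]] := Hd i; rewrite /B rnormM ler_wpM2l ?rnorm_ge0 //.
  by rewrite rnormM expr2; apply: ler_pM; rewrite ?rnorm_ge0.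
have K0 : 0 <= `|K| by [].
have KK (h : V) : K * rnorm h <= `|K| * rnorm h by rewrite ler_wpM2r ?rnorm_ge0 ?ler_norm.
pose L : {linear V -> R[i]} := (SA \*: l1 \+ SB \*: l2).
have LE h : L h = SA * l1 h + SB * l2 h by [].
(* The first summand bounds the quadratic remainder, the second the linear map L. *)
pose C := 3 * Y * `|K| ^+ 2 + (rnorm SA + rnorm SB) * `|K|.
have K1 : 0 < `|K| + 1 by rewrite ltr_wpDl.
have [YK AB] : 0 <= 3 * Y * `|K| ^+ 2 /\ 0 <= (rnorm SA + rnorm SB) * `|K|.
  by split; rewrite ?mulr_ge0 ?exprn_ge0 ?addr_ge0 ?rnorm_ge0.
apply: (@rnorm_differentiable R V _ w L C (`|K| + 1)^-1); first by rewrite invr_gt0.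
  move=> h; rewrite LE; apply: le_trans (rnormD _ _) _; rewrite !rnormM.
  have h1 := le_trans (l1K h) (KK h); have h2 := le_trans (l2K h) (KK h).
  apply: le_trans (lerD (ler_wpM2l (rnorm_ge0 SA) h1) (ler_wpM2l (rnorm_ge0 SB) h2)) _.
  rewrite -mulrDl mulrA ler_wpM2r ?rnorm_ge0 // /C lerDr //.
move=> h; rewrite -[_^-1]mul1r ler_pdivlMr // => hK.
pose H := `|K| * rnorm h.
have H0 : 0 <= H by rewrite mulr_ge0 ?rnorm_ge0.
have H1 : H <= 1 by apply: le_trans hK; rewrite /H mulrC ler_wpM2l ?rnorm_ge0 // lerDl.
have k1 : rnorm (l1 h) <= H := le_trans (l1K h) (KK h).
have k2 : rnorm (l2 h) <= H := le_trans (l2K h) (KK h).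
have [g1 G1] := term_ccvg (w + h); have [g0 G0] := term_ccvg w.
rewrite (climE G1) (climE G0) LE opprD addrA ![_ * l1 h]mulrC ![_ * l2 h]mulrC.
have U := ccvgB (ccvgB (ccvgB G1 G0) (ccvgM (l1 h) HA)) (ccvgM (l2 h) HB).
have U3 : 3 * Y * H ^+ 2 <= C * rnorm h ^+ 2.
  by rewrite /H exprMn mulrA ler_wpM2r ?exprn_ge0 ?rnorm_ge0 // /C lerDl.
apply: le_trans U3; apply: (ccvg_le U); exists 0%N => n _.
rewrite !mulr_sumr -!sumrB; apply: le_trans (_ : \sum_(i < n) rnorm (x i) * lnorm M (th i) ^+ 2 * (3 * H ^+ 2) <= _).
  have tri (F : nat -> R[i]) m : rnorm (\sum_(i < m) F i) <= \sum_(i < m) rnorm (F i).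
    elim: m => [|m IH]; first by rewrite !big_ord0 rnorm0.
    by rewrite !big_ord_recr /=; apply: le_trans (rnormD _ _) _; rewrite lerD2r.
  apply: le_trans (tri (fun i => term (w + h) i - term w i - l1 h * A i - l2 h * B i) n) _.
  apply: ler_sum => i _; rewrite /term /A /B y1D y2D.
  have [[_ /(_ _ (le_trans k1 H1))[_ q1 q2]] [_ /(_ _ (le_trans k2 H1))[_ q3 q4]]] := Hd i.
  move: (e1 i) (e2 i) q1 q2 q3 q4.
  set p1 := lev _ (y1 w); set p2 := lev _ (y2 w).
  set P1 := lev _ (y1 w + _); set P2 := lev _ (y2 w + _); set N := lnorm M (th i).
  move=> f1 f2 q1 q2 q3 q4.
  have -> : x i * (P1 * P2) - x i * (p1 * p2) - l1 h * (x i * ((d i).1 * p2))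
      - l2 h * (x i * (p1 * (d i).2)) =
    x i * (p1 * (P2 - p2 - l2 h * (d i).2) + (P1 - p1 - l1 h * (d i).1) * p2
       + (P1 - p1) * (P2 - p2)) by ring.
  rewrite rnormM -mulrA; apply: ler_wpM2l; first exact: rnorm_ge0.
  have N0 : 0 <= N by exact: L0.
  have q1' : rnorm (P1 - p1) <= N * H by apply: le_trans q1 _; rewrite ler_wpM2l.
  have q3' : rnorm (P2 - p2) <= N * H by apply: le_trans q3 _; rewrite ler_wpM2l.
  have sq (z : R[i]) : rnorm z <= H -> N * rnorm z ^+ 2 <= N * H ^+ 2.
    by move=> zH; rewrite ler_wpM2l // lerXn2r // nnegrE rnorm_ge0.
  have q2' := le_trans q2 (sq _ k1); have q4' := le_trans q4 (sq _ k2).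
  apply: le_trans (_ : N * (N * H ^+ 2) + N * H ^+ 2 * N + N * H * (N * H) <= _); last first.
    by rewrite le_eqVlt; apply/orP; left; apply/eqP; ring.
  apply: le_trans (rnormD _ _) _; apply: lerD; last first.
    by rewrite rnormM; apply: ler_pM; rewrite ?rnorm_ge0.
  apply: le_trans (rnormD _ _) _; rewrite !rnormM.
  by apply: lerD; apply: ler_pM; rewrite ?rnorm_ge0.
rewrite -mulr_suml [3 * Y]mulrC -mulrA; apply: ler_wpM2r; last exact: HY.
by rewrite mulr_ge0 // exprn_ge0.
Qed.

End HolomorphicSeries.

(** * Connectedness *)

Section Connectedness.
Context (T : topologicalType).

Lemma connected_pairwise (A : set T) :
  (forall x y, A x -> A y -> exists C : set T, [/\ connected C, C x, C y & C `<=` A]) ->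
  connected A.
Proof.
move=> H; have [->|/set0P[x Ax]] := eqVneq A set0; first exact: connected0.
have /choice[C HC] : forall y, exists C : set T, A y -> [/\ connected C, C x, C y & C `<=` A].
  move=> y; have [Ay|nAy] := pselect (A y); last by exists set0.
  by have [C HC] := H x y Ax Ay; exists C.
have -> : A = \bigcup_(y in A) C y.
  apply/seteqP; split => [y Ay|z [y Ay]]; last by have [_ _ _] := HC y Ay; apply.
  by exists y => //; have [] := HC y Ay.
apply: bigcup_connected => [|y Ay]; last by have [] := HC y Ay.
by exists x => y Ay; have [] := HC y Ay.
Qed.

(** A separation of A puts each connected piece of N on one side. As N is dense, overlapping
    neighbourhoods agree on the side, so it is locally constant on U, hence constant; points of A
    follow, being limits of N. *)
Lemma connected_locally_dense (U A N : set T) : connected U -> A `<=` U ->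
  N `&` U `<=` A -> (forall Q : set T, open Q -> Q !=set0 -> Q `<=` U -> N `&` Q !=set0) ->
  (forall x, U x -> exists Q : set T, [/\ open Q, Q x, Q `<=` U & connected (N `&` Q)]) ->
  connected A.
Proof.
move=> cU AU NA dense loc; apply/connectedP => E [E0 EA sE].
have EsU b : E b `<=` U by move=> x Ex; apply: AU; rewrite EA; case: b Ex; [right|left].
(* By density x is in the closure of the piece of N in Q, so it lies on the same side as that
   piece. *)
have near x (Q : set T) : open Q -> Q x -> Q `<=` U -> A x ->
    connected (N `&` Q) -> (exists2 b, N `&` Q `<=` E b & E b x).
  move=> opQ Qx QU Ax cNO.
  have NE : N `&` Q `<=` E false `|` E true.
    by rewrite -EA => z [Nz Qz]; apply: NA; split=> //; exact: QU.
  have clx b : N `&` Q `<=` E b -> closure (E b) x.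
    move=> NOb B /= nB; have [z [Nz [Bz Qz]]] : N `&` (B° `&` Q) !=set0.
      apply: dense; [exact: openI (open_interior _) _| by exists x|by move=> z [_ /QU]].
    by exists z; split; [apply: NOb|exact: interior_subset].
  move: Ax; rewrite EA => Ax; have [NO|NO] := connected_subset sE NE cNO.
    exists false => //; case: Ax => // Ex; case: sE => s1 _.
    have : (closure (E false) `&` E true) x by split=> //; exact: clx.
    by rewrite s1.
  exists true => //; case: Ax => // Ex; case: sE => _ s1.
  have : (E false `&` closure (E true)) x by split=> //; exact: clx.
  by rewrite s1.
have NO0 (Q : set T) x : open Q -> Q x -> Q `<=` U -> N `&` Q !=set0.
  by move=> opQ Qx QU; apply: dense => //; exists x.
(* The points near which N is on the side [false]: B is nonempty, open and closed in U. *)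
pose B := [set x | U x /\ exists Q : set T, [/\ open Q, Q x, Q `<=` U & N `&` Q `<=` E false]].
have sub x : U x -> exists b (Q : set T), [/\ open Q, Q x, Q `<=` U & N `&` Q `<=` E b].
  move=> Ux; have [Q [opQ Qx QU cNO]] := loc x Ux.
  have [z [Nz Qz]] := NO0 Q x opQ Qx QU.
  have [|b NOb _] := near z Q opQ Qz QU _ cNO; first by apply: NA; split=> //; exact: QU.
  by exists b, Q.
have Edisj x : E false x -> E true x -> False.
  move=> h1 h2; have : (E false `&` E true) x by [].
  by rewrite (separated_disjoint sE).
have BU : B = U.
  apply: cU.
  - have [x Ex] := E0 false; exists x; split; first exact: EsU Ex.
    have [Q [opQ Qx QU cNO]] := loc x (EsU _ _ Ex).
    have [|b NOb Eb] := near x Q opQ Qx QU _ cNO; first by rewrite EA; left.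
    by exists Q; split=> //; case: b NOb Eb => // _ Eb; case: (Edisj x).
  - exists (\bigcup_(Q in [set Q : set T | [/\ open Q, Q `<=` U & N `&` Q `<=` E false]]) Q).
      by apply: bigcup_open => Q [].
    apply/seteqP; split=> [x [Ux [Q [? ? ? ?]]]|x [Ux [Q [? ? ?] Qx]]]; split=> //.
      by exists Q.
    by exists Q.
  - exists (~` \bigcup_(Q in [set Q : set T | [/\ open Q, Q `<=` U & N `&` Q `<=` E true]]) Q).
      by apply: open_closedC; apply: bigcup_open => Q [].
    apply/seteqP; split=> [x [Ux [Q [opQ Qx QU NO]]]|x [Ux nO]]; split=> //.
      move=> [Q' [opQ' QU' NO'] Qx'].
      have [z [Nz [Qz Qz']]] := NO0 (Q `&` Q') x (openI opQ opQ') (conj Qx Qx') (subIset (or_introl QU)).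
      by apply: (Edisj z); [apply: NO|apply: NO'].
    have [b0 [Q [opQ Qx QU NO]]] := sub x Ux; case: b0 NO => NO; last by exists Q.
    by exfalso; apply: nO; exists Q.
have [x Ex] := E0 true; have : B x by rewrite BU; exact: EsU Ex.
move=> [Ux [Q [opQ Qx QU NO]]].
have [Q' [opQ' Qx' QU' cNO]] := loc x Ux.
have [|b NOb Eb] := near x Q' opQ' Qx' QU' _ cNO; first by rewrite EA; right.
have [z [Nz [Qz Qz']]] := NO0 (Q `&` Q') x (openI opQ opQ') (conj Qx Qx') (subIset (or_introl QU)).
case: b NOb Eb => NOb Eb; last exact: Edisj Eb Ex.
by apply: (Edisj z); [apply: NO|apply: NOb].
Qed.

End Connectedness.

Lemma connected_setX (T1 T2 : topologicalType) (A : set T1) (B : set T2) :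
  connected A -> connected B -> connected (A `*` B).
Proof.
move=> cA cB; apply: connected_pairwise => -[a b] [a' b'] [/= Aa Bb] [/= Aa' Bb'].
exists ((fun z => (a, z)) @` B `|` (fun z => (z, b')) @` A); split.
- apply: connectedU.
  + by exists (a, b'); split; [exists b'|exists a].
  + apply: connected_continuous_connected => //; apply: continuous_subspaceT => z.
    by apply: cvg_pair => /=; [exact: cvg_cst|exact: cvg_id].
  + apply: connected_continuous_connected => //; apply: continuous_subspaceT => z.
    by apply: cvg_pair => /=; [exact: cvg_id|exact: cvg_cst].
- by left; exists b.
- by right; exists a'.
- by move=> _ [[z Bz <-]|[z Az <-]].
Qed.

Section Frames.
Context (R : realType).

Lemma connected_segment (V : normedModType R[i]) (z z' : V) :
  connected ((fun t : R => z + (t%:C)%C *: (z' - z)) @` `[0, 1]).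
Proof.
apply: connected_continuous_connected; first exact: segment_connected.
apply: continuous_subspaceT => t P /nbhs_rnormP[e e0 He].
have p : 0 < rnorm (z' - z) + 1 by rewrite ltr_wpDl ?rnorm_ge0.
apply/nbhs_normP; exists (e / (rnorm (z' - z) + 1)); first exact: divr_gt0.
move=> s /=; rewrite ltr_pdivlMr // => h; apply: He.
rewrite opprD addrACA subrr add0r -scalerBl -rmorphB rnormZ rnormR distrC.
by apply: le_lt_trans h; rewrite ler_wpM2l // lerDl.
Qed.

(* The vector fe1 moves the coordinate fr1 only, and fe2 moves fr2 only.  The
   last condition is where the sup norm is needed. *)
Record frame (V : normedModType R[i]) := Frame {
  fr1 : {linear V -> R[i]};
  fr2 : {linear V -> R[i]};
  fe1 : V;
  fe2 : V;
  fK : R;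
  fK_gt0 : 0 < fK;
  fr1K : forall h, rnorm (fr1 h) <= fK * rnorm h;
  fr2K : forall h, rnorm (fr2 h) <= fK * rnorm h;
  fr11 : fr1 fe1 = 1;
  fr12 : fr1 fe2 = 0;
  fr21 : fr2 fe1 = 0;
  fr22 : fr2 fe2 = 1;
  fmix : forall z z' x r, rnorm (z - x) < r -> rnorm (z' - x) < r ->
    rnorm (z + fr2 (z' - z) *: fe2 - x) < r
}.

End Frames.

(** * The dense, locally connected union of hyperplanes *)

Section PolarHyperplanes.
Context (R : realType) (V : normedModType R[i]) (F : frame V) (c : V).
Context (be : nat -> R[i]).
Hypothesis be_dense : forall t (e : R), 0 < e -> exists n, rnorm (be n - t) < e.

Definition crd1 z := fr1 F (z - c).
Definition crd2 z := fr2 F (z - c).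
Definition polar z : Prop := exists j, crd1 z = be j \/ crd2 z = be j.

Lemma crd1D z h : crd1 (z + h) = crd1 z + fr1 F h.
Proof. by rewrite /crd1 addrAC linearD. Qed.

Lemma crd2D z h : crd2 (z + h) = crd2 z + fr2 F h.
Proof. by rewrite /crd2 addrAC linearD. Qed.

Lemma crd1_frame z a b : crd1 (z + a *: fe1 F + b *: fe2 F) = crd1 z + a.
Proof.
rewrite !crd1D !linearZ /= fr11 fr12 scaler0 addr0; congr (_ + _).
exact: mulr1.
Qed.

Lemma crd2_frame z a b : crd2 (z + a *: fe1 F + b *: fe2 F) = crd2 z + b.
Proof.
rewrite !crd2D !linearZ /= fr21 fr22 scaler0 addr0; congr (_ + _).
exact: mulr1.
Qed.

Lemma crd1_lip z z' : rnorm (crd1 z - crd1 z') <= fK F * rnorm (z - z').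
Proof. by rewrite /crd1 -linearB opprB addrA subrK; exact: fr1K. Qed.

Lemma crd2_lip z z' : rnorm (crd2 z - crd2 z') <= fK F * rnorm (z - z').
Proof. by rewrite /crd2 -linearB opprB addrA subrK; exact: fr2K. Qed.

Lemma polar_dense z (e : R) : 0 < e -> exists2 z', rnorm (z' - z) < e & polar z'.
Proof.
move=> e0; have p : 0 < rnorm (fe1 F) + 1 by rewrite ltr_wpDl ?rnorm_ge0.
have [n hn] := be_dense (crd1 z) (divr_gt0 e0 p).
exists (z + (be n - crd1 z) *: fe1 F); last first.
  by exists n; left; rewrite crd1D linearZ /= fr11 [_ *: _]mulr1 subrKC.
rewrite addrAC subrr add0r rnormZ; move: hn; rewrite ltr_pdivlMr //.
by apply: le_lt_trans; rewrite ler_wpM2l ?rnorm_ge0 // lerDl.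
Qed.

(** A hyperplane meets the ball in a convex set, so points are joined by broken lines inside the
    hyperplanes, turning at the corners that [fmix] keeps in the ball. *)
Lemma polar_ball_connected x (r : R) :
  connected (polar `&` [set z | rnorm (z - x) < r]).
Proof.
have seg z z' y : rnorm (z - x) < r -> rnorm (z' - x) < r ->
    ((fun t : R => z + (t%:C)%C *: (z' - z)) @` `[0, 1]) y ->
    rnorm (y - x) < r /\ forall l : {linear V -> R[i]}, l (z - c) = l (z' - c) -> l (y - c) = l (z - c).
  move=> hz hz' [t]; rewrite /= in_itv /= => /andP[t0 t1] <-; split.
    have -> : z + (t%:C)%C *: (z' - z) - x = ((1 - t)%:C)%C *: (z - x) + (t%:C)%C *: (z' - x).
      have E : (t%:C)%C *: (z' - x) - (t%:C)%C *: (z - x) = (t%:C)%C *: (z' - z).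
        by rewrite -scalerBr opprB addrA subrK.
      by rewrite rmorphB /= scalerBl scale1r -[RHS]addrA [X in _ = _ + X]addrC E addrAC.
    apply: le_lt_trans (rnormD _ _) _; rewrite !rnormZ !rnormR.
    rewrite !ger0_norm //; last by rewrite subr_ge0.
    have [->|tn0] := eqVneq t 0; first by rewrite subr0 mul1r mul0r addr0.
    have {}t0 : 0 < t by rewrite lt_neqAle eq_sym tn0.
    have h1 : (1 - t) * rnorm (z - x) <= (1 - t) * r.
      by rewrite ler_wpM2l ?subr_ge0 // ltW.
    have h2 : t * rnorm (z' - x) < t * r by rewrite ltr_pM2l.
    by lra.
  move=> l lz; have -> : z + (t%:C)%C *: (z' - z) - c = (z - c) + (t%:C)%C *: ((z' - c) - (z - c)).
    by rewrite opprB addrA subrK addrAC.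
  by rewrite linearD linearZ /= (linearB l (z' - c)) lz subrr [_ *: _]mulr0 addr0.
pose sg (z z' : V) := ((fun t : R => z + (t%:C)%C *: (z' - z)) @` `[0, 1]).
have sg0 z z' : sg z z' z by exists 0; [rewrite /= in_itv /= lexx ler01|rewrite scale0r addr0].
have sg1 z z' : sg z z' z'.
  by exists 1; [rewrite /= in_itv /= lexx ler01|rewrite scale1r subrKC].
(* Any two hyperplanes of different directions meeting the ball meet inside it. *)
have cross z z' j j' : rnorm (z - x) < r -> rnorm (z' - x) < r ->
    crd1 z = be j -> crd2 z' = be j' -> exists C : set V,
    [/\ connected C, C z, C z' & C `<=` polar `&` [set z | rnorm (z - x) < r]].
  move=> hz hz' bz bz'; pose m := z + fr2 F (z' - z) *: fe2 F.
  have hm : rnorm (m - x) < r by apply: fmix.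
  have m1 : crd1 m = be j by rewrite crd1D linearZ /= fr12 [_ *: _]mulr0 addr0.
  have m2 : crd2 m = be j'.
    rewrite crd2D linearZ /= fr22 [_ *: _]mulr1 -bz' /crd2 -linearD; congr (fr2 F _).
    by rewrite addrAC subrKC.
  exists (sg z m `|` sg m z'); split.
  - apply: connectedU; [by exists m|exact: connected_segment|exact: connected_segment].
  - by left.
  - by right.
  move=> y [] hy; split.
  - have [_ H] := seg _ _ _ hz hm hy; exists j; left; rewrite /crd1 H //.
    by rewrite -/(crd1 m) m1.
  - by case: (seg _ _ _ hz hm hy).
  - have [_ H] := seg _ _ _ hm hz' hy; exists j'; right; rewrite /crd2 H //.
    by rewrite -/(crd2 m) m2.
  - by case: (seg _ _ _ hm hz' hy).
apply: connected_pairwise => z z' [[j pz] hz] [[j' pz'] hz'].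
(* Two parallel hyperplanes are joined through a transverse one. *)
have move1 (u e : V) t : rnorm (u - x) < r -> exists n, rnorm (u + (be n - t) *: e - x) < r.
  move=> hu; have p : 0 < rnorm e + 1 by rewrite ltr_wpDl ?rnorm_ge0.
  have q : 0 < r - rnorm (u - x) by rewrite subr_gt0.
  have [n] := be_dense t (divr_gt0 q p); rewrite ltr_pdivlMr // => hn; exists n.
  rewrite addrAC; apply: le_lt_trans (rnormD _ _) _; rewrite rnormZ.
  have h1 : rnorm (be n - t) * rnorm e <= rnorm (be n - t) * (rnorm e + 1).
    by rewrite ler_wpM2l ?rnorm_ge0 // lerDl.
  by lra.
have join (C1 C2 P : set V) u v w : [/\ connected C1, C1 u, C1 v & C1 `<=` P] ->
    [/\ connected C2, C2 w, C2 v & C2 `<=` P] ->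
    exists C, [/\ connected C, C u, C w & C `<=` P].
  move=> [c1 h1 h2 h3] [c2 h4 h5 h6]; exists (C1 `|` C2); split.
  - by apply: connectedU => //; exists v.
  - by left.
  - by right.
  - by move=> y [/h3|/h6].
have sym (P : set V) u v : (exists C, [/\ connected C, C u, C v & C `<=` P]) ->
    exists C, [/\ connected C, C v, C u & C `<=` P].
  by move=> [C [? ? ? ?]]; exists C.
case: pz pz' => pz [] pz'.
- have [n hn] := move1 z (fe2 F) (crd2 z) hz.
  have bn : crd2 (z + (be n - crd2 z) *: fe2 F) = be n.
    by rewrite crd2D linearZ /= fr22 [_ *: _]mulr1 subrKC.
  have [C1 H1] := cross _ _ _ _ hz hn pz bn.
  have [C2 H2] := cross _ _ _ _ hz' hn pz' bn.
  exact: join H1 H2.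
- exact: cross hz hz' pz pz'.
- by apply: sym; exact: cross hz' hz pz' pz.
- have [n hn] := move1 z (fe1 F) (crd1 z) hz.
  have bn : crd1 (z + (be n - crd1 z) *: fe1 F) = be n.
    by rewrite crd1D linearZ /= fr11 [_ *: _]mulr1 subrKC.
  have [C1 H1] := sym _ _ _ (cross _ _ _ _ hn hz bn pz).
  have [C2 H2] := sym _ _ _ (cross _ _ _ _ hn hz' bn pz').
  exact: join H1 H2.
Qed.

End PolarHyperplanes.

Section RowFrame.
Context (R : realType) (n : nat) (s : R).

Definition scaled_coord (j : 'I_n) (h : 'rV[R[i]]_n) : R[i] :=
  ((s^-1)%:C)%C * h 0 j.

Lemma scaled_coord_linear j : linear (scaled_coord j).
Proof. by move=> a u v; rewrite /scaled_coord !mxE /GRing.scale /=; ring. Qed.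

HB.instance Definition _ j := GRing.isLinear.Build R[i] 'rV[R[i]]_n R[i] _
  (scaled_coord j) (scaled_coord_linear j).

Lemma rnorm_row_lt (h : 'rV[R[i]]_n) (e : R) : 0 < e ->
  rnorm h < e <-> forall j, rnorm (h 0 j) < e.
Proof.
move=> e0; have := @mx_norm_ball R[i] 1 n.
move=> /(congr1 (fun b => b 0 (e%:C)%C h)) E.
have -> : (rnorm h < e) = (`|h| < (e%:C)%C) by rewrite rnormE ltcR.
have E2 : ball_ (fun x : 'rV[R[i]]_n => `|x|) 0 (e%:C)%C h = (`|h| < (e%:C)%C) :> Prop.
  by rewrite /ball_ /= sub0r normrN.
rewrite -E2 -E; split.
  move=> [_ H] j; have := H 0 j; rewrite -ball_normE /= mxE sub0r normrN.
  by rewrite rnormE ltcR.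
move=> H; split; first by rewrite ltcR.
move=> i j; rewrite -ball_normE /= mxE sub0r normrN rnormE ltcR (ord1 i); exact: H.
Qed.

Lemma rnorm_entry (h : 'rV[R[i]]_n) j : rnorm (h 0 j) <= rnorm h.
Proof.
rewrite leNgt; apply/negP => hj.
have p : 0 < rnorm (h 0 j) := le_lt_trans (rnorm_ge0 _) hj.
by have /(rnorm_row_lt h p)/(_ j) := hj; rewrite ltxx.
Qed.

End RowFrame.

(** The first two entries divided by s, so that the point with normalized coordinates (1, 1) is
    within s of the base point. Adding [fr2 (z' - z) *: fe2] to z replaces its second entry by that
    of z', which a sup norm ball allows entry by entry. *)
Lemma row_frame (R : realType) (n : nat) (s : R) : (2 <= n)%N -> 0 < s ->
  exists F : frame 'rV[R[i]]_n, rnorm (fe1 F + fe2 F) <= s.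
Proof.
move=> n2 s0; have n0 : (0 < n)%N by exact: leq_trans n2.
pose i0 := Ordinal n0; pose i1 := Ordinal n2.
have i01 : (i0 == i1) = false by [].
have i10 : (i1 == i0) = false by [].
have sne : (s%:C)%C != 0 :> R[i] by rewrite -[0]/(0%:C)%C (inj_eq (@complexI R)) gt_eqF.
have ss : ((s^-1)%:C)%C * (s%:C)%C = 1 :> R[i] by rewrite fmorphV mulVf.
pose e j : 'rV[R[i]]_n := (s%:C)%C *: delta_mx 0 j.
have sc j k : scaled_coord s j (e k) = (j == k)%:R.
  by rewrite /scaled_coord !mxE eqxx /= mulrA ss mul1r.
have bnd (j : 'I_n) (h : 'rV[R[i]]_n) : rnorm (scaled_coord s j h) <= s^-1 * rnorm h.
  rewrite /scaled_coord rnormM rnormR ger0_norm ?invr_ge0 ?(ltW s0) //.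
  by rewrite ler_wpM2l ?invr_ge0 ?(ltW s0) // rnorm_entry.
unshelve eexists (@Frame R _ (scaled_coord s i0) (scaled_coord s i1) (e i0) (e i1) s^-1
  _ (bnd _) (bnd _) _ _ _ _ _); rewrite ?sc ?invr_gt0 ?eqxx ?i01 ?i10 //=.
  move=> z z' x r hz hz'; have r0 : 0 < r := le_lt_trans (rnorm_ge0 _) hz.
  apply/(rnorm_row_lt _ r0) => j; rewrite !mxE /scaled_coord.
  have [->|jn] := eqVneq j i1.
    have -> : z 0 i1 + ((s^-1)%:C)%C * (z' - z) 0 i1 * ((s%:C)%C * true%:R) - x 0 i1 = (z' - x) 0 i1.
      rewrite !mxE mulr1; rewrite mulrAC [_ * (s%:C)%C]ss; ring.
    by move/(rnorm_row_lt _ r0) : hz'.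
  rewrite andbF !mulr0 addr0.
  by move/(rnorm_row_lt _ r0)/(_ j) : hz; rewrite !mxE.
apply/ler_addgt0Pr => d d0; apply/ltW/rnorm_row_lt; first by rewrite addr_gt0.
move=> j; rewrite !mxE eqxx /=.
have [->|_] := eqVneq j i0.
  by rewrite i01 mulr0 addr0 mulr1 rnormR gtr0_norm // ltrDl.
rewrite mulr0 add0r; case: eqP => _; last by rewrite mulr0 rnorm0 addr_gt0.
by rewrite mulr1 rnormR gtr0_norm // ltrDl.
Qed.

(** * The singular set *)

Lemma closed_lipschitz (R : realType) (X : normedModType R[i])
    (phi : nat -> X -> R) (L : nat -> R) :
  (forall j x y, `|phi j x - phi j y| <= L j * rnorm (x - y)) ->
  closed [set x | forall j, 0 <= phi j x].
Proof.
move=> H; rewrite -[X in closed X]setCK; apply: open_closedC.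
rewrite openE => x nx; apply/nbhs_rnormP.
have [j xj] : exists j, phi j x < 0.
  by apply: contrapT => h; apply: nx => j; rewrite leNgt; apply/negP => ?; apply: h; exists j.
have p : 0 < `|L j| + 1 by rewrite ltr_wpDl.
exists (- phi j x / (`|L j| + 1)); first by rewrite divr_gt0 // oppr_gt0.
move=> y; rewrite ltr_pdivlMr // => h /(_ j); apply/negP; rewrite -ltNge.
have := H j y x; rewrite ler_norml => /andP[_ h1].
have : L j * rnorm (y - x) <= rnorm (y - x) * (`|L j| + 1).
  rewrite mulrC ler_wpM2l ?rnorm_ge0 //.
  by apply: le_trans (ler_norm _) _; rewrite lerDl.
by lra.
Qed.

Section SingularSets.
Context (R : realType) (be : nat -> R[i]) (et : nat -> R) (ka : R).
Hypothesis be_neq1 : forall j, be j <> 1.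
Hypothesis et_gt0 : forall j, 0 < et j.
Hypothesis ka_gt0 : 0 < ka.

Definition rho (V : normedModType R[i]) (F : frame V) (c z : V) : R :=
  rnorm (crd1 F c z - 1) + rnorm (crd2 F c z - 1).

Definition sing (V W : normedModType R[i]) (FV : frame V) (c : V)
    (FW : frame W) (d : W) (z : V) (w : W) : Prop :=
  forall j, ka * rho FW d w * et j <= rnorm (crd1 FV c z - be j) /\
            ka * rho FW d w * et j <= rnorm (crd2 FV c z - be j).

Lemma rho_ge0 (V : normedModType R[i]) (F : frame V) c z : 0 <= rho F c z.
Proof. by rewrite /rho addr_ge0 ?rnorm_ge0. Qed.

Lemma crd1_dist (V : normedModType R[i]) (F : frame V) c z z' b :
  `|rnorm (crd1 F c z - b) - rnorm (crd1 F c z' - b)| <= fK F * rnorm (z - z').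
Proof.
apply: le_trans (rnorm_dist _ _) _.
by rewrite opprB addrA subrK; exact: crd1_lip.
Qed.

Lemma crd2_dist (V : normedModType R[i]) (F : frame V) c z z' b :
  `|rnorm (crd2 F c z - b) - rnorm (crd2 F c z' - b)| <= fK F * rnorm (z - z').
Proof.
apply: le_trans (rnorm_dist _ _) _.
by rewrite opprB addrA subrK; exact: crd2_lip.
Qed.

Lemma rho_dist (V : normedModType R[i]) (F : frame V) c z z' :
  `|rho F c z - rho F c z'| <= 2 * fK F * rnorm (z - z').
Proof.
rewrite /rho opprD addrACA; apply: le_trans (ler_normD _ _) _.
by have := crd1_dist F c z z' 1; have := crd2_dist F c z z' 1; lra.
Qed.

Lemma sing_set_closed (V W X : normedModType R[i]) (FV : frame V) (c : V)
    (FW : frame W) (d : W) (f : X -> V) (g : X -> W) :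
  (forall x y, rnorm (f x - f y) <= rnorm (x - y)) ->
  (forall x y, rnorm (g x - g y) <= rnorm (x - y)) ->
  closed [set x | sing FV c FW d (f x) (g x)].
Proof.
move=> fL gL.
have -> : [set x | sing FV c FW d (f x) (g x)] =
    [set x | forall j, 0 <= rnorm (crd1 FV c (f x) - be j) - ka * rho FW d (g x) * et j] `&`
    [set x | forall j, 0 <= rnorm (crd2 FV c (f x) - be j) - ka * rho FW d (g x) * et j].
  apply/seteqP; split=> [x H|x [H1 H2] j].
    by split=> j; rewrite subr_ge0; case: (H j).
  by split; rewrite -subr_ge0; [exact: H1|exact: H2].
have key (phi : nat -> X -> R) : (forall j x y, `|phi j x - phi j y| <= fK FV * rnorm (f x - f y)) ->
    closed [set x | forall j, 0 <= phi j x - ka * rho FW d (g x) * et j].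
  move=> H; apply: (@closed_lipschitz _ _ _ (fun j => fK FV + ka * et j * (2 * fK FW))) => j x y.
  have -> : phi j x - ka * rho FW d (g x) * et j - (phi j y - ka * rho FW d (g y) * et j) =
    (phi j x - phi j y) - ka * et j * (rho FW d (g x) - rho FW d (g y)) by ring.
  apply: le_trans (ler_normB _ _) _; rewrite mulrDl; apply: lerD.
    by apply: le_trans (H j x y) _; rewrite ler_wpM2l // ltW // fK_gt0.
  have p : 0 <= ka * et j by rewrite mulr_ge0 ?ltW.
  rewrite normrM ger0_norm // -mulrA ler_wpM2l //.
  apply: le_trans (rho_dist FW d (g x) (g y)) _; rewrite ler_wpM2l // mulr_ge0 // ltW //; exact: fK_gt0.
by apply: closedI; apply: key => j x y; [exact: crd1_dist|exact: crd2_dist].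
Qed.

(** If rho vanished at w, both coordinates of w would be 1, but one is a root and no root is 1. So
    the lower bounds are positive, while a coordinate of z is equal to some be j. *)
Lemma sing_polar (V W : normedModType R[i]) (FV : frame V) (c : V)
    (FW : frame W) (d : W) z w :
  polar FV c be z -> polar FW d be w -> ~ sing FV c FW d z w.
Proof.
move=> [j zj] [k wk] /(_ j)[h1 h2].
have r0 : 0 < rho FW d w.
  rewrite lt_neqAle rho_ge0 andbT eq_sym; apply/eqP => E.
  have e1 := rnorm_ge0 (crd1 FW d w - 1); have e2 := rnorm_ge0 (crd2 FW d w - 1).
  by case: wk => wk; apply: (be_neq1 (j := k)); rewrite -wk; apply/subr0_eq/rnorm_eq0;
     move: E; rewrite /rho; lra.
have p : 0 < ka * rho FW d w * et j by rewrite !mulr_gt0.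
case: zj => zj; [move: h1|move: h2]; rewrite zj subrr rnorm0 leNgt p //.
Qed.

(** The point has normalized coordinates (1, 1), where rho vanishes; near it ka times rho stays
    below e. *)
Lemma sing_slice_nbhs (V W : normedModType R[i]) (FV : frame V) (c : V)
    (FW : frame W) (d : W) z e : 0 < e ->
  (forall j, e * et j <= rnorm (crd1 FV c z - be j) /\
             e * et j <= rnorm (crd2 FV c z - be j)) ->
  nbhs (d + (fe1 FW + fe2 FW)) [set w | sing FV c FW d z w].
Proof.
move=> e0 H; apply/nbhs_rnormP.
set w0 := d + _.
have K0 := fK_gt0 FW.
exists (e / (ka * (2 * fK FW))); first by rewrite divr_gt0 ?mulr_gt0.
move=> w; rewrite ltr_pdivlMr ?mulr_gt0 // => hw j.
have r0 : rho FW d w0 = 0.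
  rewrite /rho /crd1 /crd2 /w0 addrAC subrr add0r !linearD /= fr11 fr12 fr21 fr22.
  by rewrite addr0 add0r subrr rnorm0 addr0.
have := rho_dist FW d w w0; rewrite r0 subr0 ger0_norm ?rho_ge0 // => h.
have h2 : ka * rho FW d w <= e.
  apply: ltW; apply: le_lt_trans hw; rewrite mulrCA ler_wpM2l ?(ltW ka_gt0) //.
  by apply: le_trans h _; rewrite mulrC.
have h3 : ka * rho FW d w * et j <= e * et j by rewrite ler_wpM2r // ltW.
by case: (H j) => ? ?; split; apply: le_trans h3 _.
Qed.

(** This is what fixes the size of ka: here rho is at least 1, so membership would force z1 to be at
    distance at least 1 + |be 0| from be 0, although |z1| < 1/2. *)
Lemma sing_center (V W : normedModType R[i]) (FV : frame V) (c : V)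
    (FW : frame W) (d : W) z w : 1 + rnorm (be 0%N) <= ka * et 0%N ->
  rnorm (crd1 FV c z) < 1 / 2 -> rnorm (crd1 FW d w) <= 1 / 2 ->
  rnorm (crd2 FW d w) <= 1 / 2 -> ~ sing FV c FW d z w.
Proof.
move=> hk h1 h2 h3 /(_ 0%N)[+ _]; apply/negP; rewrite -ltNge.
have r1 : 1 <= rho FW d w.
  have := rnormB (crd1 FW d w) (crd1 FW d w - 1).
  have := rnormB (crd2 FW d w) (crd2 FW d w - 1).
  rewrite !opprB ![_ + (1 - _)]addrC !subrK rnorm1 /rho; lra.
apply: le_lt_trans (rnormB _ _) _.
apply: lt_le_trans (_ : ka * et 0%N <= _); first by lra.
rewrite mulrAC -[X in X <= _]mulr1 ler_wpM2l // mulr_ge0 ?(ltW ka_gt0) // ltW //.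
Qed.

End SingularSets.

(** * The set S in the product, and its slices *)

Section CrossSet.
Context (R : realType) (V W : normedModType R[i]).
Context (FV : frame V) (FW : frame W) (c : V) (d : W).
Context (D : set V) (G : set W).
Hypotheses (opD : open D) (opG : open G).
Hypotheses (Dc : D c) (Gd : G d).
Hypothesis De : D (c + (fe1 FV + fe2 FV)).
Hypothesis Ge : G (d + (fe1 FW + fe2 FW)).
Context (th : nat -> lfac R) (be : nat -> R[i]) (et : nat -> R) (ka : R).
Hypothesis be_dense : forall t (e : R), 0 < e -> exists n, rnorm (be n - t) < e.
Hypothesis be_neq1 : forall j, be j <> 1.
Hypothesis et_gt0 : forall j, 0 < et j.
Hypothesis ka_gt0 : 0 < ka.
Hypothesis ka_ge : 1 + rnorm (be 0%N) <= ka * et 0%N.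

Definition cross_set : set (V * W) := (D `*` G) `&`
  ([set x | sing be et ka FV c FW d x.1 x.2] `|`
   [set x | sing be et ka FW d FV c x.2 x.1]).

Let N : set (V * W) := [set z | polar FV c be z] `*` [set w | polar FW d be w].

Lemma fst_lip (x y : V * W) : rnorm (x.1 - y.1) <= rnorm (x - y).
Proof.
by case: x y => [a b] [a' b']; rewrite (_ : (a, b) - (a', b') = (a - a', b - b')) //
  rnorm_pair le_max lexx.
Qed.

Lemma snd_lip (x y : V * W) : rnorm (x.2 - y.2) <= rnorm (x - y).
Proof.
by case: x y => [a b] [a' b']; rewrite (_ : (a, b) - (a', b') = (a - a', b - b')) //
  rnorm_pair le_max lexx orbT.
Qed.

Lemma cross_set_closed : relatively_closed (D `*` G) cross_set.
Proof.
exists ([set x | sing be et ka FV c FW d x.1 x.2] `|`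
   [set x | sing be et ka FW d FV c x.2 x.1]) => //.
apply: closedU; apply: sing_set_closed => //; try exact: fst_lip; exact: snd_lip.
Qed.

Lemma polar_cross_set x : N x -> ~ cross_set x.
Proof.
by move=> [Nz Nw] [_ [|]]; apply: sing_polar.
Qed.

Lemma ball_pair (x : V * W) (r : R) :
  [set y | rnorm (y - x) < r] =
  [set z | rnorm (z - x.1) < r] `*` [set w | rnorm (w - x.2) < r].
Proof.
apply/seteqP; split=> -[z w]; case: x => a b /=;
  rewrite (_ : (z, w) - (a, b) = (z - a, w - b)) // rnorm_pair gt_max.
  by move=> /andP[].
by move=> [? ?]; apply/andP.
Qed.

Lemma polar_pair_dense (U : set (V * W)) : open U -> U !=set0 -> N `&` U !=set0.
Proof.
rewrite openE => oU [x Ux]; have /nbhs_rnormP[e e0 He] := oU x Ux.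
have [z hz pz] := polar_dense FV c be_dense x.1 e0.
have [w hw pw] := polar_dense FW d be_dense x.2 e0.
exists (z, w); split=> //; apply: He.
by have : [set y | rnorm (y - x) < e] (z, w) by rewrite ball_pair.
Qed.

Lemma cross_set_interior : cross_set° = set0.
Proof.
rewrite -subset0 => x Sx.
have [y [Ny Sy]] := polar_pair_dense (open_interior cross_set) (ex_intro _ x Sx).
exact: (polar_cross_set Ny (interior_subset Sy)).
Qed.

(** Balls of the product are products of balls, so N meets each of them in a product of two
    connected sets; [connected_locally_dense] applies. *)
Lemma cross_set_nonseparating : does_not_separate_domains (D `*` G) cross_set.
Proof.
move=> U [U0 oU cU] UDG; apply: (connected_locally_dense (U := U) (N := N)) => //.
- by move=> x [Nx Ux]; split=> //; exact: polar_cross_set.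
- by move=> Q oQ Q0 _; exact: polar_pair_dense.
move=> x Ux; have := oU; rewrite openE => /(_ x Ux)/nbhs_rnormP[e e0 He].
exists [set y | rnorm (y - x) < e]; split => //.
- exact: (@open_ball_rnorm R (V * W)%type x e).
- by rewrite /= subrr rnorm0.
have -> : N `&` [set y | rnorm (y - x) < e] =
  ([set z | polar FV c be z] `&` [set z | rnorm (z - x.1) < e]) `*`
  ([set w | polar FW d be w] `&` [set w | rnorm (w - x.2) < e]).
  rewrite ball_pair; apply/seteqP; split=> [y [[? ?] [? ?]]|y [[? ?] [? ?]]]; by split.
by apply: connected_setX; apply: polar_ball_connected.
Qed.

(** Otherwise the slice at a would contain a neighbourhood of d + (fe1 + fe2), a point of G. *)
Lemma thin_x_small a : thin_x D cross_set a -> forall e : R, 0 < e -> exists j,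
  rnorm (crd1 FV c a - be j) < e * et j \/ rnorm (crd2 FV c a - be j) < e * et j.
Proof.
move=> [Da Sa] e e0; apply: contrapT => H.
have H' j : e * et j <= rnorm (crd1 FV c a - be j) /\ e * et j <= rnorm (crd2 FV c a - be j).
  by split; rewrite leNgt; apply/negP => h; apply: H; exists j; [left|right].
have hs := sing_slice_nbhs et_gt0 ka_gt0 FW d e0 H'.
have : (xsection cross_set a)° (d + (fe1 FW + fe2 FW)).
  have := opG; rewrite openE => /(_ _ Ge) hG.
  apply: filterS (filterI hs hG) => w [hw Gw].
  by rewrite /= /xsection /= inE; split => //; left.
by rewrite Sa.
Qed.

Lemma thin_y_small b : thin_y G cross_set b -> forall e : R, 0 < e -> exists j,
  rnorm (crd1 FW d b - be j) < e * et j \/ rnorm (crd2 FW d b - be j) < e * et j.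
Proof.
move=> [Gb Sb] e e0; apply: contrapT => H.
have H' j : e * et j <= rnorm (crd1 FW d b - be j) /\ e * et j <= rnorm (crd2 FW d b - be j).
  by split; rewrite leNgt; apply/negP => h; apply: H; exists j; [left|right].
have hs := sing_slice_nbhs et_gt0 ka_gt0 FV c e0 H'.
have : (ysection cross_set b)° (c + (fe1 FV + fe2 FV)).
  have := opD; rewrite openE => /(_ _ De) hD.
  apply: filterS (filterI hs hD) => z [hz Dz].
  by rewrite /= /ysection /= inE; split => //; right.
by rewrite Sb.
Qed.

(** The slice at b misses the dense set of polar points z. *)
Lemma polar_thin_y b : G b -> polar FW d be b -> thin_y G cross_set b.
Proof.
move=> Gb pb; split=> //; rewrite -subset0 => z Sz.
have /nbhs_rnormP[e e0 He] : nbhs z (ysection cross_set b) by exact: Sz.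
have [z' hz' pz'] := polar_dense FV c be_dense z e0.
have := He z' hz'; rewrite /ysection /= inE.
by apply: polar_cross_set.
Qed.

End CrossSet.

(** * Non-extension *)

Section LineUniqueness.
Context (R : realType).
Local Open Scope complex_scope.

Lemma differentiable_line (X : normedModType R[i]) (Q : X -> R[i]) (x v : X) t :
  differentiable Q (x + t *: v) -> differentiable (fun t : R[i] => Q (x + t *: v)) t.
Proof.
by move=> dQ; apply: (@differentiable_comp _ _ _ _ (fun t : R[i] => x + t *: v) Q).
Qed.

Lemma square_uniqueness_line (X : normedModType R[i]) (Q : X -> R[i]) (x v : X) (r : R) :
  0 < r -> (forall t, snorm t <= r -> differentiable Q (x + t *: v)) ->
  (forall t, snorm t = r -> Q (x + t *: v) = 0) ->
  forall t, snorm t <= r -> Q (x + t *: v) = 0.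
Proof.
move=> r0 dQ bQ [a b]; rewrite /snorm /= ge_max => /andP[ar br].
apply: (@square_uniqueness R (fun t => Q (x + t *: v)) r) => // a' b' ha hb.
  by apply: differentiable_line; apply: dQ; rewrite /snorm /= ge_max ha.
by move=> h; apply: bQ; rewrite /snorm /=; case: h => hr; [rewrite max_l|rewrite max_r]; rewrite ?hr.
Qed.

End LineUniqueness.

Section MeromorphicQuotient.
Context (R : realType) (X : normedModType R[i]).

(* The singular set of a meromorphic function is contained in the zero set of
   any local denominator. *)
Lemma meromorphic_quotient (Om P : set X) (h : X -> R[i]) (a : X) :
  meromorphic_on Om P h -> Om a ->
  exists (U : set X) (phi psi : X -> R[i]),
    [/\ [/\ open U, U a & U `<=` Om], holomorphic_on U phi /\ holomorphic_on U psi,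
        [set z | U z /\ psi z = 0]° = set0
      & forall z, U z -> psi z != 0 -> ~ P z /\ psi z * h z = phi z].
Proof.
move=> [_ _ Hloc Hsing] Oa; have [U [phi [psi [[oU Ua UO] [hphi hpsi] int0 E]]]] := Hloc a Oa.
exists U, phi, psi; split=> // z Uz pz.
have nPz : ~ P z.
  move=> Pz; apply: (Hsing z Pz).
  (* Where psi is nonzero, phi / psi is a holomorphic extension of h, which the last clause of
     [meromorphic_on] forbids at points of P. *)
  exists (U `&` [set y | psi y != 0]), (fun y => phi y * (psi y)^-1); split.
  - rewrite openE => y [Uy py].
    have [e e0 He] := differentiable_rnorm_cont (hpsi y Uy) (rnorm_gt0 py).
    have := oU; rewrite openE => /(_ y Uy) hU.
    have hp : nbhs y [set t | rnorm (t - y) < e] by apply/nbhs_rnormP; exists e.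
    apply: filterS (filterI hU hp) => t [Ut /He ht]; split=> //=.
    by apply: contraTneq ht => ->; rewrite sub0r rnormN ltxx.
  - by [].
  - move=> y [Uy py]; apply: (differentiableM (hphi y Uy)).
    by apply: differentiableV => //; exact: hpsi.
  - by move=> y [Uy py] nPy; rewrite -(E y Uy nPy) mulrC mulKf.
by split=> //; exact: E.
Qed.

End MeromorphicQuotient.

(** As |t| is at most twice [snorm t], each coefficient is at most 5 r'; the four terms add up to at
    most 5/8 eps. *)
Lemma combination_near (R : realType) (X : normedModType R[i])
    (v1 v2 v3 v4 x0 : X) (eps : R) : 0 < eps -> exists2 r : R, 0 < r &
  forall x r', 0 < r' -> r' <= r -> rnorm (x - x0) < eps / 4 ->
  forall t1 t2 t3 t4 b1 b2 b3 b4,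
    snorm t1 <= 2 * r' -> snorm t2 <= 2 * r' -> snorm t3 <= 2 * r' -> snorm t4 <= 2 * r' ->
    rnorm b1 <= r' -> rnorm b2 <= r' -> rnorm b3 <= r' -> rnorm b4 <= r' ->
    rnorm (x + (t1 - b1) *: v1 + (t2 - b2) *: v2 + (t3 - b3) *: v3 + (t4 - b4) *: v4 - x0) < eps.
Proof.
move=> e0; pose E := 1 + (rnorm v1 + rnorm v2 + (rnorm v3 + rnorm v4)).
have E0 : 0 < E by rewrite ltr_pwDl // !addr_ge0 ?rnorm_ge0.
exists (eps / (8 * E)); first by rewrite divr_gt0 ?mulr_gt0.
move=> x r' r'0 r'le hx t1 t2 t3 t4 b1 b2 b3 b4 h1 h2 h3 h4 g1 g2 g3 g4.
have term (t b : R[i]) (v : X) : snorm t <= 2 * r' -> rnorm b <= r' ->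
    rnorm ((t - b) *: v) <= 5 * r' * rnorm v.
  move=> ht hb; rewrite rnormZ ler_wpM2r ?rnorm_ge0 //.
  apply: le_trans (rnormB _ _) _; have := rnorm_le_snorm t; clear -ht hb; lra.
have -> : x + (t1 - b1) *: v1 + (t2 - b2) *: v2 + (t3 - b3) *: v3 + (t4 - b4) *: v4 - x0 =
  (x - x0) + (((t1 - b1) *: v1 + (t2 - b2) *: v2) + ((t3 - b3) *: v3 + (t4 - b4) *: v4)).
  by rewrite !addrA ![_ - x0 + _]addrAC.
apply: le_lt_trans (rnormD _ _) _.
have s2 (u v : X) (a b : R) : rnorm u <= a -> rnorm v <= b -> rnorm (u + v) <= a + b.
  by move=> ha hb; apply: le_trans (rnormD _ _) _; apply: lerD.
apply: le_lt_trans (lerD (lexx _) (s2 _ _ _ _ (s2 _ _ _ _ (term _ _ v1 h1 g1) (term _ _ v2 h2 g2))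
  (s2 _ _ _ _ (term _ _ v3 h3 g3) (term _ _ v4 h4 g4)))) _.
rewrite -!mulrDr.
have : 5 * r' * (rnorm v1 + rnorm v2 + (rnorm v3 + rnorm v4)) <= 5 * r' * E.
  by rewrite ler_wpM2l ?mulr_ge0 ?(ltW r'0) // /E lerDr.
have : 5 * r' * E <= 5 * (eps / (8 * E)) * E by rewrite ler_wpM2r ?(ltW E0) // ler_wpM2l.
have -> : 5 * (eps / (8 * E)) * E = 5 / 8 * eps by field; rewrite gt_eqF.
move: (_ * (_ + _)) (_ * E) (rnorm _) hx => A B C'; clear -e0; lra.
Qed.

Section NonExtension.
Context (R : realType) (V W : normedModType R[i]).
Context (FV : frame V) (FW : frame W) (c : V) (d : W).
Local Notation X := (V * W)%type.

Definition pv1 : X := (fe1 FV, 0).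
Definition pv2 : X := (fe2 FV, 0).
Definition pv3 : X := (0, fe1 FW).
Definition pv4 : X := (0, fe2 FW).

(* The point obtained from x by setting its four distinguished coordinates. *)
Definition setc (x : X) (t1 t2 t3 t4 : R[i]) : X :=
  x + (t1 - crd1 FV c x.1) *: pv1 + (t2 - crd2 FV c x.1) *: pv2
    + (t3 - crd1 FW d x.2) *: pv3 + (t4 - crd2 FW d x.2) *: pv4.

(** This lemma and the next three put [setc] into the form of a complex line in one coordinate,
    ready for [square_uniqueness_line]. *)
Lemma setc1 x t1 t2 t3 t4 : setc x t1 t2 t3 t4 = setc x 0 t2 t3 t4 + t1 *: pv1.
Proof.
rewrite /setc; have -> : (t1 - crd1 FV c x.1) *: pv1 = (0 - crd1 FV c x.1) *: pv1 + t1 *: pv1.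
  by rewrite -scalerDl sub0r addrC.
by rewrite !addrA -!(addrAC _ (t1 *: pv1)).
Qed.

Lemma setc2 x t1 t2 t3 t4 : setc x t1 t2 t3 t4 = setc x t1 0 t3 t4 + t2 *: pv2.
Proof.
rewrite /setc; have -> : (t2 - crd2 FV c x.1) *: pv2 = (0 - crd2 FV c x.1) *: pv2 + t2 *: pv2.
  by rewrite -scalerDl sub0r addrC.
by rewrite !addrA -!(addrAC _ (t2 *: pv2)).
Qed.

Lemma setc3 x t1 t2 t3 t4 : setc x t1 t2 t3 t4 = setc x t1 t2 0 t4 + t3 *: pv3.
Proof.
rewrite /setc; have -> : (t3 - crd1 FW d x.2) *: pv3 = (0 - crd1 FW d x.2) *: pv3 + t3 *: pv3.
  by rewrite -scalerDl sub0r addrC.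
by rewrite !addrA -!(addrAC _ (t3 *: pv3)).
Qed.

Lemma setc4 x t1 t2 t3 t4 : setc x t1 t2 t3 t4 = setc x t1 t2 t3 0 + t4 *: pv4.
Proof.
rewrite /setc; have -> : (t4 - crd2 FW d x.2) *: pv4 = (0 - crd2 FW d x.2) *: pv4 + t4 *: pv4.
  by rewrite -scalerDl sub0r addrC.
by rewrite !addrA.
Qed.

Lemma setc_crd x : setc x (crd1 FV c x.1) (crd2 FV c x.1) (crd1 FW d x.2) (crd2 FW d x.2) = x.
Proof. by rewrite /setc !subrr !scale0r !addr0. Qed.

Lemma setcE x t1 t2 t3 t4 : setc x t1 t2 t3 t4 =
  (x.1 + (t1 - crd1 FV c x.1) *: fe1 FV + (t2 - crd2 FV c x.1) *: fe2 FV,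
   x.2 + (t3 - crd1 FW d x.2) *: fe1 FW + (t4 - crd2 FW d x.2) *: fe2 FW).
Proof.
case: x => z w; rewrite /setc /pv1 /pv2 /pv3 /pv4 /=.
by congr (_, _); rewrite /= !scaler0 !addr0.
Qed.

Lemma crd_setc x t1 t2 t3 t4 (y := setc x t1 t2 t3 t4) :
  [/\ crd1 FV c y.1 = t1, crd2 FV c y.1 = t2, crd1 FW d y.2 = t3 & crd2 FW d y.2 = t4].
Proof.
have [-> ->] : y.1 = x.1 + (t1 - crd1 FV c x.1) *: fe1 FV + (t2 - crd2 FV c x.1) *: fe2 FV /\
    y.2 = x.2 + (t3 - crd1 FW d x.2) *: fe1 FW + (t4 - crd2 FW d x.2) *: fe2 FW.
  by rewrite /y setcE.
by rewrite !crd1_frame !crd2_frame !subrKC.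
Qed.

(** The boundary of the square is filled in one coordinate at a time, the others staying on it or
    already filled. *)
Lemma square4_uniqueness (Q : X -> R[i]) (x : X) (r : R) : 0 < r ->
  (forall t1 t2 t3 t4, snorm t1 <= r -> snorm t2 <= r -> snorm t3 <= r -> snorm t4 <= r ->
    differentiable Q (setc x t1 t2 t3 t4)) ->
  (forall t1 t2 t3 t4, snorm t1 = r -> snorm t2 = r -> snorm t3 = r -> snorm t4 = r ->
    Q (setc x t1 t2 t3 t4) = 0) ->
  forall t1 t2 t3 t4, snorm t1 <= r -> snorm t2 <= r -> snorm t3 <= r -> snorm t4 <= r ->
    Q (setc x t1 t2 t3 t4) = 0.
Proof.
move=> r0 dQ b0.
have le (t : R[i]) : snorm t = r -> snorm t <= r by move=> ->.
have b1 t1 t2 t3 t4 : snorm t1 <= r -> snorm t2 = r -> snorm t3 = r -> snorm t4 = r ->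
    Q (setc x t1 t2 t3 t4) = 0.
  move=> h1 h2 h3 h4; rewrite setc1; apply: square_uniqueness_line h1 => // t ht; rewrite -setc1.
    by apply: dQ => //; apply: le.
  exact: b0.
have b2 t1 t2 t3 t4 : snorm t1 <= r -> snorm t2 <= r -> snorm t3 = r -> snorm t4 = r ->
    Q (setc x t1 t2 t3 t4) = 0.
  move=> h1 h2 h3 h4; rewrite setc2; apply: square_uniqueness_line h2 => // t ht; rewrite -setc2.
    by apply: dQ => //; apply: le.
  exact: b1.
have b3 t1 t2 t3 t4 : snorm t1 <= r -> snorm t2 <= r -> snorm t3 <= r -> snorm t4 = r ->
    Q (setc x t1 t2 t3 t4) = 0.
  move=> h1 h2 h3 h4; rewrite setc3; apply: square_uniqueness_line h3 => // t ht; rewrite -setc3.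
    by apply: dQ => //; apply: le.
  exact: b2.
move=> t1 t2 t3 t4 h1 h2 h3 h4.
rewrite setc4; apply: square_uniqueness_line h4 => // t ht; rewrite -setc4.
  by apply: dQ => //; apply: le.
exact: b3.
Qed.

(** The third coordinate gets the range 2 r' because it will be moved from the square to a nearby
    root. *)
Lemma setc_near (eps : R) : 0 < eps -> exists2 r : R, 0 < r &
  forall r', 0 < r' -> r' <= r -> exists2 rho, 0 < rho & forall x, rnorm (x - (c, d)) < rho ->
    [/\ snorm (crd1 FV c x.1) <= r', snorm (crd2 FV c x.1) <= r',
        snorm (crd1 FW d x.2) <= r' & snorm (crd2 FW d x.2) <= r'] /\
    forall t1 t2 t3 t4, snorm t1 <= r' -> snorm t2 <= r' -> snorm t3 <= 2 * r' -> snorm t4 <= r' ->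
      rnorm (setc x t1 t2 t3 t4 - (c, d)) < eps.
Proof.
move=> e0; have [r r0 Hr] := combination_near pv1 pv2 pv3 pv4 (c, d) e0.
exists r => // r' r'0 r'le.
have [k1 k2] : 0 < fK FV /\ 0 < fK FW by split; exact: fK_gt0.
have K0 : 0 < fK FV + fK FW by rewrite addr_gt0.
exists (Order.min (r' / (fK FV + fK FW)) (eps / 4)); first by rewrite lt_min !divr_gt0.
move=> x; rewrite lt_min ltr_pdivlMr // => /andP[x1 x2].
have cK (k z : R) : 0 <= k -> k <= fK FV + fK FW -> z <= rnorm (x - (c, d)) -> k * z <= r'.
  move=> k0 kK zx; apply: le_trans (ltW x1); rewrite [leRHS]mulrC.
  by apply: le_trans (ler_wpM2l k0 zx) _; rewrite ler_wpM2r ?rnorm_ge0.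
have z1 : rnorm (x.1 - c) <= rnorm (x - (c, d)) by exact: (fst_lip x (c, d)).
have z2 : rnorm (x.2 - d) <= rnorm (x - (c, d)) by exact: (snd_lip x (c, d)).
have kV : fK FV <= fK FV + fK FW by rewrite lerDl ltW.
have kW : fK FW <= fK FV + fK FW by rewrite lerDr ltW.
have c1 : rnorm (crd1 FV c x.1) <= r'.
  by apply: le_trans (fr1K FV _) _; apply: cK => //; exact: ltW.
have c2 : rnorm (crd2 FV c x.1) <= r'.
  by apply: le_trans (fr2K FV _) _; apply: cK => //; exact: ltW.
have c3 : rnorm (crd1 FW d x.2) <= r'.
  by apply: le_trans (fr1K FW _) _; apply: cK => //; exact: ltW.
have c4 : rnorm (crd2 FW d x.2) <= r'.
  by apply: le_trans (fr2K FW _) _; apply: cK => //; exact: ltW.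
split; first by split; apply: le_trans (snorm_le_rnorm _) _.
have rr : r' <= 2 * r' by rewrite ler_peMl ?(ltW r'0) // ler1n.
move=> t1 t2 t3 t4 h1 h2 h3 h4; apply: (Hr _ r') => //; exact: le_trans rr.
Qed.

End NonExtension.

Section NonMeromorphic.
Context (R : realType) (V W : normedModType R[i]).
Context (FV : frame V) (FW : frame W) (c : V) (d : W).
Context (D : set V) (G : set W).
Hypotheses (opD : open D) (opG : open G).
Hypotheses (Dc : D c) (Gd : G d).
Hypothesis De : D (c + (fe1 FV + fe2 FV)).
Hypothesis Ge : G (d + (fe1 FW + fe2 FW)).
Context (th : nat -> lfac R) (be : nat -> R[i]) (et : nat -> R) (ka : R).
Hypothesis be_dense : forall t (e : R), 0 < e -> exists n, rnorm (be n - t) < e.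
Hypothesis be_neq1 : forall j, be j <> 1.
Hypothesis et_gt0 : forall j, 0 < et j.
Hypothesis ka_gt0 : 0 < ka.
Hypothesis ka_ge : 1 + rnorm (be 0%N) <= ka * et 0%N.
Hypothesis th_be : forall n m, (n < m)%N -> lev (th m) (be n) = 0.
Hypothesis th_large : forall t m (e : R) (K : nat), snorm t = 2^-1 ^+ m -> 0 < e ->
  exists2 n, rnorm (be n - t) < e &
  forall t1 t2 t3, squares t1 -> squares t2 -> squares t3 ->
  K%:R <= rnorm (\sum_(i < n.+1) lev (th i) t1 * lev (th i) t2 *
                   (lev (th i) (be n) * lev (th i) t3)).
Hypothesis th_small : forall a1 a2, (forall e : R, 0 < e -> exists j,
    rnorm (a1 - be j) < e * et j \/ rnorm (a2 - be j) < e * et j) ->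
  forall M : R, 0 <= M -> exists n0, forall n, (n0 <= n)%N -> lsmall M n (th n) a1 a2.

Local Notation S := (cross_set FV FW c d D G be et ka).

Definition cross_fun (x : V * W) : R[i] := clim (fun n => \sum_(i < n)
  lev (th i) (crd1 FV c x.1) * lev (th i) (crd2 FV c x.1) *
  (lev (th i) (crd1 FW d x.2) * lev (th i) (crd2 FW d x.2))).

(** Points of A and of B are extremely well approximated by the roots, so with that variable fixed
    the series converges and is differentiable everywhere in the other; this also provides the
    extension across S. *)
Lemma cross_fun_separately_holomorphic :
  separately_holomorphic D (thin_x D S) G (thin_y G S) S cross_fun.
Proof.
split=> [a Aa|b Bb].
  exists (fun w => cross_fun (a, w)) => // w _.
  have sm := th_small (thin_x_small opG Ge et_gt0 ka_gt0 Aa).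
  exact: (differentiable_series (fr1K FW) (fr2K FW) (crd1D FW d) (crd2D FW d) sm w).
exists (fun z => cross_fun (z, b)) => // z _.
have sm := th_small (thin_y_small opD De et_gt0 ka_gt0 Bb).
have -> : (fun z => cross_fun (z, b)) = (fun z => clim (fun n => \sum_(i < n)
    lev (th i) (crd1 FW d b) * lev (th i) (crd2 FW d b) *
    (lev (th i) (crd1 FV c z) * lev (th i) (crd2 FV c z)))).
  apply/funext => y; congr clim; apply/funext => n.
  by apply: eq_bigr => i _; rewrite mulrC.
exact: (differentiable_series (fr1K FV) (fr2K FV) (crd1D FV c) (crd2D FV c) sm z).
Qed.

(** All terms of index above n contain the factor theta_i(be n) = 0. *)
Lemma cross_fun_pole x n : crd1 FW d x.2 = be n ->
  cross_fun x = \sum_(i < n.+1)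
    lev (th i) (crd1 FV c x.1) * lev (th i) (crd2 FV c x.1) *
    (lev (th i) (be n) * lev (th i) (crd2 FW d x.2)).
Proof.
move=> xn; apply/climE/(ccvg_const (N := n.+1)) => m nm; rewrite xn.
rewrite -(subnKC nm) big_split_ord /= [X in _ + X]big1 ?addr0 // => i _.
by rewrite th_be ?mul0r ?mulr0 // ltn_addr.
Qed.

Lemma cross_fun_no_extension : ~ exists (P : set (V * W)) (fhat : V * W -> R[i]),
  meromorphic_on (D `*` G) P fhat /\
  forall x, (cross D (thin_x D S) G (thin_y G S) `\` S) x -> ~ P x ->
    fhat x = cross_fun x.
Proof.
move=> [P [fhat [mer agree]]].
have [U [phi [psi [[oU Ux UDG] [hphi hpsi] int0 E]]]] :=
  meromorphic_quotient mer (conj Dc Gd : (D `*` G) (c, d)).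
have bound x : U x -> (cross D (thin_x D S) G (thin_y G S) `\` S) x ->
    rnorm (psi x) * rnorm (cross_fun x) <= rnorm (phi x).
  move=> Uxx Xx; have [->|px] := eqVneq (psi x) 0; first by rewrite rnorm0 mul0r rnorm_ge0.
  by have [nP <-] := E x Uxx px; rewrite (agree x Xx nP) rnormM.
pose M := rnorm (phi (c, d)) + 1.
have [eps e0 He] : exists2 eps : R, 0 < eps & forall x, rnorm (x - (c, d)) < eps ->
    U x /\ rnorm (phi x) <= M.
  have := oU; rewrite openE => /(_ _ Ux)/nbhs_rnormP[e1 e10 H1].
  have [e2 e20 H2] := differentiable_rnorm_cont (hphi _ Ux) (@ltr01 R).
  exists (Order.min e1 e2); first by rewrite lt_min e10.
  move=> x; rewrite lt_min => /andP[x1 x2]; split; first exact: H1.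
  have := rnormD (phi x - phi (c, d)) (phi (c, d)); rewrite subrK => h.
  by apply: le_trans h _; rewrite /M addrC lerD2l ltW // H2.
have [r r0 Hr] := setc_near FV FW c d e0.
(* With r' below 1/8, coordinates of [snorm] at most 2 r' have modulus below 1/2, as [sing_center]
   requires. *)
have r80 : 0 < Order.min r (1 / 8) by rewrite lt_min r0 divr_gt0.
have [m hm] := exists_half_lt 1 r80.
pose r' : R := 2^-1 ^+ m.
have r'E : r' = 1 / 2 ^+ m by rewrite /r' exprVn mul1r.
have r'0 : 0 < r' by rewrite /r' exprn_gt0 // invr_gt0.
move: hm; rewrite -r'E lt_min => /andP[/ltW r'r r'8].
have [rho0 rp Hrho] := Hr r' r'0 r'r.
have r'2 : r' <= 2 * r' by rewrite ler_peMl ?(ltW r'0) // ler1n.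
have pz x : rnorm (x - (c, d)) < rho0 -> U x /\ psi x = 0.
  move=> hx; have [[k1 k2 k3 k4] near] := Hrho x hx.
  have near' t1 t2 t3 t4 : snorm t1 <= r' -> snorm t2 <= r' -> snorm t3 <= r' -> snorm t4 <= r' ->
      rnorm (setc FV FW c d x t1 t2 t3 t4 - (c, d)) < eps.
    by move=> *; apply: near => //; apply: le_trans r'2.
  rewrite -(setc_crd FV FW c d x); split; first exact: (He _ (near' _ _ _ _ k1 k2 k3 k4)).1.
  apply: (@square4_uniqueness R V W FV FW c d psi x r') => // {k1 k2 k3 k4}.
    by move=> t1 t2 t3 t4 h1 h2 h3 h4; apply/hpsi/(He _ (near' _ _ _ _ h1 h2 h3 h4)).1.
  move=> t1 t2 t3 t4 h1 h2 h3 h4; apply/eqP/negPn/negP => pn0.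
  have le t : snorm t = r' -> snorm t <= r' by move=> ->.
  set y := setc _ _ _ _ _ _ _ _ _ in pn0.
  have Uy : U y by apply: (He _ (near' _ _ _ _ _ _ _ _)).1; exact: le.
  have q0 := rnorm_gt0 pn0.
  have [dl dl0 Hdl] := differentiable_rnorm_cont (hpsi y Uy) (divr_gt0 q0 (ltr0n _ 2)).
  have [K hK] : exists K : nat, M < rnorm (psi y) / 2 * K%:R.
    exists (Num.bound (M / (rnorm (psi y) / 2))).
    rewrite mulrC -ltr_pdivrMr ?divr_gt0 //; apply: archi_boundP.
    by rewrite !divr_ge0 ?rnorm_ge0 // /M addr_ge0 ?rnorm_ge0.
  pose N3 := rnorm (pv3 V FW) + 1.
  have N30 : 0 < N3 by rewrite ltr_wpDl ?rnorm_ge0.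
  (* The first bound keeps y' within dl of y, so that psi is still at least half as large; the
     second keeps be n in the square of half-side 2 r'. *)
  have em0 : 0 < Order.min (dl / N3) (r' / 2) by rewrite lt_min !divr_gt0.
  have [n] := th_large K h3 em0.
  rewrite lt_min ltr_pdivlMr // => /andP[n1 n2] large.
  pose y' := setc FV FW c d x t1 t2 (be n) t4.
  have bn3 : snorm (be n) <= 2 * r'.
    have := snormD (be n - t3) t3; rewrite subrK h3 => h; apply: le_trans h _.
    have := snorm_le_rnorm (be n - t3); lra.
  have y'eps : rnorm (y' - (c, d)) < eps by apply: near => //; apply: le.
  have [Uy' phiy'] := He y' y'eps.
  have [e1 e2 e3 e4] := crd_setc FV FW c d x t1 t2 (be n) t4; rewrite -/y' in e1 e2 e3 e4.
  have yy' : rnorm (y' - y) < dl.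
    have -> : y' - y = (be n - t3) *: pv3 V FW.
      by rewrite /y' /y [X in X - _]setc3 [X in _ - X]setc3 [X in X - _]addrC addrKA -scalerBl.
    rewrite rnormZ; apply: le_lt_trans n1; rewrite ler_wpM2l ?rnorm_ge0 //.
    by rewrite /N3 lerDl.
  have [Dy Gy] := UDG _ Uy'.
  have small4 t : snorm t <= 2 * r' -> rnorm t < 1 / 2.
    by move=> ht; apply: le_lt_trans (rnorm_le_snorm t) _; lra.
  have small2 t : snorm t = r' -> rnorm t < 1 / 2.
    by move=> ht; apply: le_lt_trans (rnorm_le_snorm t) _; rewrite ht; lra.
  have nS : ~ S y'.
    move=> [_ [|]]; apply: sing_center; rewrite ?e1 ?e2 ?e3 ?e4 //.
    - exact: small2.
    - by apply: ltW; exact: small4.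
    - by apply: ltW; exact: small2.
    - exact: small4.
    - by apply: ltW; exact: small2.
    - by apply: ltW; exact: small2.
  (* The third coordinate of y' is a root, so its second component is polar and belongs to B. *)
  have Xy' : (cross D (thin_x D S) G (thin_y G S) `\` S) y'.
    split=> //; right; split=> //; apply: polar_thin_y => //.
    by exists n; left; rewrite e3.
  have := bound y' Uy' Xy'; rewrite (cross_fun_pole e3) e1 e2 e4 => hb.
  have sq t : snorm t = r' -> squares t by exact: squares_pow.
  have hl := large t1 t2 t4 (sq _ h1) (sq _ h2) (sq _ h4).
  have hq : rnorm (psi y) / 2 <= rnorm (psi y').
    have := Hdl y' yy'; rewrite rnormC => hd.
    have := rnormD (psi y') (psi y - psi y'); rewrite subrKC.
    by move=> hd'; lra.
  have := ler_pM (ltW (divr_gt0 q0 (ltr0n _ 2))) (ler0n _ K) hq hl.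
  move=> h; have := le_lt_trans (le_trans (le_trans h hb) phiy') hK.
  by rewrite ltxx.
have : [set z | U z /\ psi z = 0]° (c, d).
  by apply/nbhs_rnormP; exists rho0.
by rewrite int0.
Qed.

End NonMeromorphic.

Theorem propositionB (R : realType) (p q : nat) (hp : (2 <= p)%N)
    (hq : (2 <= q)%N) (D : set 'rV[R[i]]_p) (G : set 'rV[R[i]]_q)
    (domD : domain D) (domG : domain G)
    (pscD : pseudoconvex D) (pscG : pseudoconvex G) :
  exists S : set ('rV[R[i]]_p * 'rV[R[i]]_q),
    [/\ relatively_closed (D `*` G) S,
        S° = set0 /\ does_not_separate_domains (D `*` G) S
      & let A := thin_x D S in
        let B := thin_y G S in
        let X := cross D A G B in
        exists2 f : 'rV[R[i]]_p * 'rV[R[i]]_q -> R[i],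
          separately_holomorphic D A G B S f
        & ~ exists (P : set ('rV[R[i]]_p * 'rV[R[i]]_q))
                   (fhat : 'rV[R[i]]_p * 'rV[R[i]]_q -> R[i]),
              meromorphic_on (D `*` G) P fhat /\
              forall x, (X `\` S) x -> ~ P x -> fhat x = f x].
Proof.
(* The scale of the frame is half the radius of a ball around c in the domain, which keeps the point
   with coordinates (1, 1) inside. *)
have corner (n : nat) (Om : set 'rV[R[i]]_n) : (2 <= n)%N -> domain Om ->
    exists (F : frame 'rV[R[i]]_n) c, Om c /\ Om (c + (fe1 F + fe2 F)).
  move=> n2 [[c Oc] oO _]; move: oO; rewrite openE => /(_ c Oc)/nbhs_rnormP[e e0 He].
  have [F hF] := row_frame n2 (divr_gt0 e0 (ltr0n R 2)).
  exists F, c; split=> //; apply: He; rewrite addrAC subrr add0r.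
  by apply: le_lt_trans hF _; rewrite ltr_pdivrMr // ltr_pMr // ltr1n.
have [FV [c [Dc De]]] := corner p D hp domD.
have [FW [d [Gd Ge]]] := corner q G hq domG.
have [_ opD _] := domD; have [_ opG _] := domG.
have [th [be [et [be_sq be_dense th_be th_large [et0 th_small]]]]] := exists_poles R.
(* The point 1 lies on the boundary of the largest square, which the roots avoid. *)
have be1 j : be j <> 1.
  move=> bj; apply: (be_sq j); rewrite bj; apply: (@squares_pow _ 0).
  by rewrite /snorm /= normr1 normr0 expr0 max_l.
pose ka := (1 + rnorm (be 0%N)) / et 0%N.
have ka0 : 0 < ka by rewrite divr_gt0 // ltr_pwDl // rnorm_ge0.
have ka1 : 1 + rnorm (be 0%N) <= ka * et 0%N by rewrite /ka divfK // gt_eqF.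
exists (cross_set FV FW c d D G be et ka); split.
- exact: cross_set_closed.
- by split; [exact: cross_set_interior|exact: cross_set_nonseparating].
- exists (cross_fun FV FW c d th).
    exact: cross_fun_separately_holomorphic.
  exact: cross_fun_no_extension.
Qed.
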